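(* Let $n \in \mathbb{N}$, $n \geq 2$, and let $\mathcal{M}_{n}$ be the Motzkin monoid of degree $n$. Let $J_{n-1}$ and $J_{n-2}$ denote the sets of partitions of degree $n$ of rank $n-1$ and $n-2$ respectively. Then the maximal subsemigroups of $\mathcal{M}_{n}$ are precisely: (a) $\mathcal{M}_{n} \setminus \{ \mathrm{id}_{n} \}$ (type (M1)); (b) the union of $\mathcal{M}_{n} \setminus J_{n - 1}$ and $$\bigcup_{i \in A} \{\alpha \in\mathcal{M}_{n} : \operatorname{rank}(\alpha) = n - 1\ \text{and}\ \{i\}\ \text{is a block of}\ \alpha\} \cup \bigcup_{i \notin A} \{\alpha \in\mathcal{M}_{n} : \operatorname{rank}(\alpha) = n - 1\ \text{and}\ \{i'\}\ \text{is a block of}\ \alpha\},$$ where $A$ is any non-empty proper subset of $\{1,\ldots,n\}$ (type (M2)); (c) $\mathcal{M}_{n} \setminus \{\alpha \in J_{n - 2} : \{i, i + 1\}\ \text{is a block of}\ \alpha\}$ for $i \in \{1, \ldots, n - 1\}$ (type (M4)); and (d) $\mathcal{M}_{n} \setminus \{\alpha \in J_{n - 2} : \{i', (i + 1)'\}\ \text{is a block of}\ \alpha\}$ for $i \in \{1, \ldots, n - 1\}$ (type (M3)). In particular, for $n \geq 2$, there are $2^{n} + 2n - 3$ maximal subsemigroups of the Motzkin monoid of degree $n$. The Motzkin monoid $\mathcal{M}_{1} = \mathcal{P}_{1}$ is a semilattice of order $2$: its maximal subsemigroups are each of its singleton subsets.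
   Context: $\mathbb{N}=\{1,2,3,\ldots\}$. A maximal subsemigroup of a semigroup $S$ is a proper subsemigroup not contained in any other proper subsemigroup. A semilattice is a commutative semigroup of idempotents. A partition of degree $n$ is an equivalence relation on $\{1,\ldots,n\}\cup\{1',\ldots,n'\}$; its classes are called blocks; a block is transverse if it contains both unprimed and primed points. The rank of a partition is its number of transverse blocks. The product $\alpha\beta$: replace each $i'$ by $i''$ in $\alpha$ to get $\alpha'$, replace each $i$ by $i''$ in $\beta$ to get $\beta'$; let $(\alpha\beta)'$ be the smallest equivalence on $\{1,\ldots,n\}\cup\{1',\ldots,n'\}\cup\{1'',\ldots,n''\}$ containing $\alpha'\cup\beta'$; then $\alpha\beta$ is the restriction of $(\alpha\beta)'$ to $\{1,\ldots,n\}\cup\{1',\ldots,n'\}$. $\mathcal{P}_n$ is the monoid of all partitions of degree $n$; its identity $\mathrm{id}_n$ has blocks $\{i,i'\}$. Order the points by $n'<(n-1)'<\cdots<1'<1<2<\cdots<n$; $\alpha$ is planar if there do not exist distinct blocks $A,X$ of $\alpha$ and points $a,b\in A$, $x,y\in X$ with $a<x<b<y$. $\mathcal{M}_n$ is the submonoid of $\mathcal{P}_n$ of planar partitions all of whose blocks have size at most $2$. Types: a maximal subsemigroup $M$ of a finite monoid $S$ arises from the $\mathscr{J}$-class $J$ if $S\setminus M\subseteq J$; when $J$ is regular, $M$ has type (M1) if $M\cap J=\varnothing$; (M2) if $M\cap J$ is a non-empty union of both $\mathscr{L}$- and $\mathscr{R}$-classes of $J$ (those in a non-empty proper subset of the $\mathscr{L}$-classes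 together with those in a non-empty proper subset of the $\mathscr{R}$-classes); (M3) if $M\cap J$ is a non-empty union of $\mathscr{L}$-classes; (M4) if $M\cap J$ is a non-empty union of $\mathscr{R}$-classes; (M5) if $M\cap J$ meets every $\mathscr{H}$-class of $J$. *)

(* Defs.v *)
From HB Require Import structures.
From mathcomp Require Import all_boot.

Set Implicit Arguments.
Unset Strict Implicit.
Unset Printing Implicit Defensive.

Local Open Scope group_scope.

#[short(type="finMonoidType")]
HB.structure Definition FinMonoid := {T of Monoid T & Finite T}.

(** Everything is relative to a subset [S] of an ambient finite monoid [T].
    In the notions involving Green's relations, [S] is meant to be a submonoid
    of [T]: since [1 \in S], the principal ideals of [S] are then [S x],
    [x S] and [S x S], with no need to adjoin an identity. *)
Section FiniteMonoid.

Variable T : finMonoidType.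
Implicit Types (S M J : {set T}) (x y : T).

Definition subsemigroup S := (S != set0) && [forall x in S, forall y in S, x * y \in S].

Definition proper_subsemigroup S M := (M \proper S) && subsemigroup M.

Definition maximal_subsemigroup S M := maxset (proper_subsemigroup S) M.

Definition semilattice S :=
  [&& subsemigroup S, [forall x in S, forall y in S, x * y == y * x]
    & [forall x in S, x * x == x]].

Definition greenL S x y := [set a * x | a in S] == [set a * y | a in S].

Definition greenR S x y := [set x * b | b in S] == [set y * b | b in S].

Definition greenJ S x y :=
  [set a * x * b | a in S, b in S] == [set a * y * b | a in S, b in S].

Definition Jclasses S : {set {set T}} := equivalence_partition (greenJ S) S.

(** The L- and R-classes of [S] contained in the J-class [J]. *)
Definition Lclasses S J : {set {set T}} := equivalence_partition (greenL S) J.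
Definition Rclasses S J : {set {set T}} := equivalence_partition (greenR S) J.

Definition regular_in S J := [forall x in J, exists a in S, x * a * x == x].

Definition arises_from S M J := (J \in Jclasses S) && (S :\: M \subset J).

Definition type_M1 S M :=
  exists J, [/\ arises_from S M J, regular_in S J & M :&: J = set0].

Definition type_M2 S M :=
  exists J, [/\ arises_from S M J, regular_in S J &
    exists P Q : {set {set T}},
      [/\ P != set0, P \proper Lclasses S J,
          Q != set0, Q \proper Rclasses S J
        & M :&: J = cover P :|: cover Q]].

Definition type_M3 S M :=
  exists J, [/\ arises_from S M J, regular_in S J &
    exists P : {set {set T}},
      [/\ P != set0, P \subset Lclasses S J & M :&: J = cover P]].

Definition type_M4 S M :=
  exists J, [/\ arises_from S M J, regular_in S J &
    exists Q : {set {set T}},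
      [/\ Q != set0, Q \subset Rclasses S J & M :&: J = cover Q]].

End FiniteMonoid.

(** [inl i] is the unprimed point i+1, [inr i] the primed point (i+1)'. *)
Definition point (n : nat) : finType := ('I_n + 'I_n)%type.

(** A partition of degree n, given by its set of blocks. *)
Record npartition (n : nat) := NPartition {
  blocks :> {set {set point n}};
  blocksP : partition blocks [set: point n] }.

HB.instance Definition _ n := [isSub for @blocks n].
HB.instance Definition _ n := [Equality of npartition n by <:].
HB.instance Definition _ n := [Choice of npartition n by <:].
HB.instance Definition _ n := [Countable of npartition n by <:].
HB.instance Definition _ n := [Finite of npartition n by <:].

Section Connect.

Variables (U V : finType) (f : U -> V) (e : rel U) (e' : rel V).
Hypothesis f_inj : injective f.
Hypothesis e_e' : forall x y, e x y -> connect e' (f x) (f y).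
Hypothesis e'_e : forall x v, e' (f x) v -> exists2 y, v = f y & connect e x y.

Lemma connect_image x v :
  connect e' (f x) v -> exists2 y, v = f y & connect e x y.
Proof.
case/connectP=> p; elim: p x => [|w p IH] x /= => [_ ->|]; first by exists x.
case/andP=> /e'_e[y -> xy] /IH{}IH /IH[z -> yz]; exists z => //.
exact: connect_trans xy yz.
Qed.

Lemma connect_embed x y : connect e' (f x) (f y) = connect e x y.
Proof.
apply/idP/idP => [/connect_image[z /f_inj -> //]|].
case/connectP=> p; elim: p x => [|w p IH] x /= => [_ ->|]; first exact: connect0.
by case/andP=> /e_e' xw /IH{}IH /IH; apply: connect_trans.
Qed.

End Connect.

Lemma connect_restrict (V : finType) (e1 e2 : rel V) (K : pred V) u v :
    (forall x y, e2 x y -> K x && K y) -> K u -> K v ->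
  connect (relU e1 e2) u v
  = connect (relU [rel x y | [&& connect e1 x y, K x & K y]] e2) u v.
Proof.
move=> e2K Ku Kv; set e' := relU (SimplRel _) _; apply/idP/idP; last first.
  apply: connect_sub => {u v Ku Kv} u v /orP[/and3P[uv _ _]|uv].
    by apply: connect_sub uv => x y xy; apply: connect1; rewrite /= xy.
  by apply: connect1; rewrite /= uv orbT.
suff H p w x : connect e' u w -> K w -> connect e1 w x -> path (relU e1 e2) x p ->
    exists w', [/\ connect e' u w', K w' & connect e1 w' (last x p)].
  case/connectP=> p up vE.
  have [w [uw Kw wv]] := H p u u (connect0 _ _) Ku (connect0 _ _) up.
  by apply: connect_trans uw (connect1 _); rewrite /= vE wv Kw -vE Kv.
elim: p w x => [|y p IH] w x uw Kw wx /= => [_|]; first by exists w.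
case/andP=> /orP[xy|xy].
  exact: IH uw Kw (connect_trans wx (connect1 xy)).
have /andP[Kx Ky] := e2K _ _ xy.
apply: (IH y y _ Ky (connect0 _ _)); apply: connect_trans uw _.
apply: (@connect_trans _ _ x); apply: connect1.
  by rewrite /e' /= wx Kw Kx.
by rewrite /e' /= xy orbT.
Qed.

Section Product.

Variable n : nat.
Implicit Types (a b c : npartition n) (x y : point n).

(** The points of the product graph: [inl (inl i)], [inl (inr i)] and [inr i]
    are respectively i+1, (i+1)'' and (i+1)'. *)
Definition point3 : finType := (point n + 'I_n)%type.

Definition upper3 x : point3 := inl x.
Definition lower3 x : point3 :=
  match x with inl i => inl (inr i) | inr i => inr i end.
Definition outer3 x : point3 :=
  match x with inl i => inl (inl i) | inr i => inr i end.

Definition glue a b : rel point3 := fun u v =>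
  [exists A in blocks a, (u \in upper3 @: A) && (v \in upper3 @: A)]
  || [exists B in blocks b, (u \in lower3 @: B) && (v \in lower3 @: B)].

Lemma glue_sym a b : symmetric (glue a b).
Proof.
move=> u v; rewrite /glue; congr (_ || _);
by apply: eq_existsb => A; rewrite [(u \in _) && _]andbC.
Qed.

Definition joined a b : rel point3 := connect (glue a b).

Lemma joined_equiv a b : {in [set: point n] & &, equivalence_rel
  (fun x y => joined a b (outer3 x) (outer3 y))}.
Proof.
move=> x y z _ _ _; split; first exact: connect0.
by move/(same_connect (sym_connect_sym (@glue_sym a b))) => /= E; apply: E.
Qed.

Definition mulnp a b : npartition n :=
  NPartition (equivalence_partitionP (@joined_equiv a b)).

Definition same a : rel (point n) := fun x y => y \in pblock a x.

Lemma samexx a x : same a x x.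
Proof. by rewrite /same mem_pblock (cover_partition (blocksP a)) inE. Qed.

Lemma same_pblockE a x y : same a x y = (pblock a x == pblock a y).
Proof.
have /and3P[_ tI _] := blocksP a.
by rewrite eq_pblock // (cover_partition (blocksP a)) inE.
Qed.

Lemma sameP a x y : reflect (exists A, [/\ A \in blocks a, x \in A & y \in A])
                            (same a x y).
Proof.
have /and3P[_ tI _] := blocksP a.
apply: (iffP idP) => [xy | [A [aA xA yA]]]; last by rewrite /same (def_pblock tI aA xA).
exists (pblock a x); split=> //; last exact: samexx.
by apply: pblock_mem; rewrite (cover_partition (blocksP a)) inE.
Qed.

Lemma npartition_inj a b : same a =2 same b -> a = b.
Proof.
move=> ab; apply/val_inj => /=.
rewrite -(equivalence_partition_pblock (blocksP a)).
rewrite -(equivalence_partition_pblock (blocksP b)).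
apply: eq_imset => x; apply/setP => y; rewrite !inE.
exact: ab.
Qed.

Lemma same_mul a b x y : same (mulnp a b) x y = joined a b (outer3 x) (outer3 y).
Proof.
by rewrite /same (pblock_equivalence_partition (@joined_equiv a b)) ?inE.
Qed.

Lemma glueP a b u v : reflect
  ((exists x y, [/\ u = upper3 x, v = upper3 y & same a x y]) \/
   (exists x y, [/\ u = lower3 x, v = lower3 y & same b x y])) (glue a b u v).
Proof.
apply: (iffP orP) => [[] | []].
- case/existsP=> A /and3P[aA /imsetP[x xA ->] /imsetP[y yA ->]].
  by left; exists x, y; split=> //; apply/sameP; exists A.
- case/existsP=> A /and3P[aA /imsetP[x xA ->] /imsetP[y yA ->]].
  by right; exists x, y; split=> //; apply/sameP; exists A.
- case=> x [y [-> -> /sameP[A [aA xA yA]]]]; left.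
  by apply/existsP; exists A; rewrite aA !imset_f.
- case=> x [y [-> -> /sameP[A [aA xA yA]]]]; right.
  by apply/existsP; exists A; rewrite aA !imset_f.
Qed.

Definition unitnp_rel : rel (point n) := fun x y =>
  match x, y with inl i, inl j | inl i, inr j | inr i, inl j | inr i, inr j => i == j end.

Lemma unitnp_equiv : {in [set: point n] & &, equivalence_rel unitnp_rel}.
Proof.
move=> x y z _ _ _; split; first by case: z => i /=.
by case: x y z => i [] j [] k /= /eqP->.
Qed.

Lemma unitnp_partition :
  partition [set ([set inl i; inr i] : {set point n}) | i : 'I_n] [set: point n].
Proof.
suff ->: [set ([set inl i; inr i] : {set point n}) | i : 'I_n]
         = equivalence_partition unitnp_rel [set: point n].
  exact: equivalence_partitionP unitnp_equiv.
have E i : [set inl i; inr i] = [set y in [set: point n] | unitnp_rel (inl i) y].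
  apply/setP=> -[] j; rewrite !inE /=.
    by rewrite orbF [RHS]eq_sym.
  by rewrite [RHS]eq_sym.
apply/setP=> B; apply/imsetP/imsetP => [[i _ ->] | [x _ ->]].
  by exists (inl i); rewrite ?inE.
by case: x => i; exists i; rewrite // E; apply/setP=> -[] j; rewrite !inE.
Qed.

Definition onenp : npartition n := NPartition unitnp_partition.

Lemma same_one x y : same onenp x y = unitnp_rel x y.
Proof.
apply/sameP/idP => [[A [/imsetP[i _ ->]]] | ].
  by rewrite !inE => /orP[] /eqP-> /orP[] /eqP-> /=.
by case: x y => i [] j /= /eqP<-; exists [set inl i; inr i];
  rewrite !inE !eqxx ?orbT; split=> //; apply: imset_f.
Qed.

Lemma mul1np : left_id onenp mulnp.
Proof.
move=> a; apply: npartition_inj => x y; rewrite same_mul; apply/idP/idP.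
  pose r (u : point3) : point n :=
    match u with inl (inl i) | inl (inr i) => inl i | inr i => inr i end.
  have rK z : r (outer3 z) = z by case: z.
  suff /(_ _ _)/[apply]: forall u v, joined onenp a u v -> same a (r u) (r v).
    by rewrite !rK.
  move=> u v /connectP[p]; elim: p u => [|w p IH] u /= => [_ ->|].
    exact: samexx.
  case/andP=> uw /IH{}IH /IH; rewrite !same_pblockE => /eqP <-.
  rewrite -same_pblockE.
  case/glueP: uw => -[z [t [-> -> ]]]; last by case: z t => i [] j.
  by rewrite same_one; case: z t => i [] j /= /eqP->; apply: samexx.
move=> xy; apply: (@connect_trans _ _ (lower3 x)); last first.
  apply: (@connect_trans _ _ (lower3 y)).
    by apply/connect1/glueP; right; exists x, y.
  case: y {xy} => i /=; last exact: connect0.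
  by apply/connect1/glueP; left; exists (inr i), (inl i); rewrite same_one /=.
case: x {xy} => i /=; last exact: connect0.
by apply/connect1/glueP; left; exists (inl i), (inr i); rewrite same_one /=.
Qed.

Lemma mulnp1 : right_id onenp mulnp.
Proof.
move=> a; apply: npartition_inj => x y; rewrite same_mul; apply/idP/idP.
  pose r (u : point3) : point n :=
    match u with inl (inl i) => inl i | inl (inr i) | inr i => inr i end.
  have rK z : r (outer3 z) = z by case: z.
  suff /(_ _ _)/[apply]: forall u v, joined a onenp u v -> same a (r u) (r v).
    by rewrite !rK.
  move=> u v /connectP[p]; elim: p u => [|w p IH] u /= => [_ ->|].
    exact: samexx.
  case/andP=> uw /IH{}IH /IH; rewrite !same_pblockE => /eqP <-.
  rewrite -same_pblockE.
  case/glueP: uw => -[z [t [-> -> ]]]; first by case: z t => i [] j.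
  by rewrite same_one; case: z t => i [] j /= /eqP->; apply: samexx.
move=> xy; apply: (@connect_trans _ _ (upper3 x)); last first.
  apply: (@connect_trans _ _ (upper3 y)).
    by apply/connect1/glueP; left; exists x, y.
  case: y {xy} => i /=; first exact: connect0.
  by apply/connect1/glueP; right; exists (inl i), (inr i); rewrite same_one /=.
case: x {xy} => i /=; first exact: connect0.
by apply/connect1/glueP; right; exists (inr i), (inl i); rewrite same_one /=.
Qed.

Definition image_rel (V : finType) (f : point n -> V) a : rel V := fun u v =>
  [exists x, exists y, [&& u == f x, v == f y & same a x y]].

Lemma image_relP (V : finType) (f : point n -> V) a u v :
  reflect (exists x y, [/\ u = f x, v = f y & same a x y]) (image_rel f a u v).
Proof.
apply: (iffP existsP) => -[x].
  by case/existsP=> y /and3P[/eqP-> /eqP-> xy]; exists x, y.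
by case=> y [-> -> xy]; exists x; apply/existsP; exists y; rewrite !eqxx.
Qed.

Let point4 : finType := (point3 + 'I_n)%type.

Let row12 x : point4 := inl (upper3 x).
Let row23 x : point4 := inl (lower3 x).
Let row34 x : point4 := match x with inl i => inl (inr i) | inr i => inr i end.

Let glue4 a b c : rel point4 :=
  relU (relU (image_rel row12 a) (image_rel row23 b)) (image_rel row34 c).

Let outer4 x : point4 :=
  match x with inl i => inl (inl (inl i)) | inr i => inr i end.

Lemma mulnpAl a b c x y :
  same (mulnp (mulnp a b) c) x y = connect (glue4 a b c) (outer4 x) (outer4 y).
Proof.
pose e1 := relU (image_rel row12 a) (image_rel row23 b).
pose K (u : point4) := if u is inl (inl (inr _)) then false else true.
have E1 p v : e1 (inl p) v -> exists2 q, v = inl q & connect (glue a b) p q.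
  case/orP=> /image_relP[s [t [-[->] -> st]]].
    by exists (upper3 t) => //; apply/connect1/glueP; left; exists s, t.
  by exists (lower3 t) => //; apply/connect1/glueP; right; exists s, t.
have E1' p q : glue a b p q -> connect e1 (inl p) (inl q).
  case/glueP=> -[s [t [-> -> st]]]; apply/connect1/orP; [left | right];
  by apply/image_relP; exists s, t.
have E4 i v : connect e1 (inr i) v -> v = inr i.
  by case/connectP=> -[|w p] //= /andP[/orP[] /image_relP[s [t []]]].
rewrite (@connect_restrict _ e1 _ K); first last.
- by case: y.
- by case: x.
- by move=> u v /image_relP[[] i [[] j [-> ->]]].
set e' := relU (SimplRel _) _.
pose f (u : point3) : point4 :=
  match u with inl (inl i) => inl (inl (inl i)) | inl (inr i) => inl (inr i)
             | inr i => inr i end.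
have -> : outer4 x = f (outer3 x) by case: x.
have -> : outer4 y = f (outer3 y) by case: y.
rewrite same_mul /joined -(@connect_embed _ _ f (glue (mulnp a b) c) e') //.
- by case=> [[i|i]|i] [[j|j]|j] // [->].
- move=> p q /glueP[] [s [t [-> -> st]]]; apply/connect1/orP.
    left; have fE z : f (upper3 z) = inl (outer3 z) by case: z.
    rewrite !fE; apply/and3P; split; [|by case: (s)|by case: (t)].
    rewrite (connect_embed _ E1' E1); last by move=> ? ? [].
    by move: st; rewrite same_mul.
  right; apply/image_relP; exists s, t; split=> //; first by case: s {st}.
  by case: t {st}.
move=> p v /orP[/and3P[pv _ Kv]|/image_relP[s [t [pE -> st]]]]; last first.
  exists (lower3 t); first by case: t {st}.
  have -> : p = lower3 s by case: p s pE {st} => [[i|i]|i] [] j // [->].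
  by apply/connect1/glueP; right; exists s, t.
have [[z pE]|[i pE]] : (exists z, p = upper3 z) \/ exists i, p = inr i.
  by case: (p) => [z|i]; [left; exists z | right; exists i].
  move: pv; have -> : f p = inl (outer3 z) by rewrite pE; case: (z).
  case/(connect_image E1)=> q vE zq.
  have [t tE]: exists t, q = outer3 t.
    by move: Kv; rewrite vE; case: (q) => [[i|//]|i] _; [exists (inl i) | exists (inr i)].
  exists (upper3 t); first by rewrite vE tE; case: (t).
  rewrite pE; apply/connect1/glueP; left; exists z, t; split=> //.
  by rewrite same_mul -tE.
move: pv; rewrite pE /= => /E4 ->; by exists (inr i).
Qed.

Lemma mulnpAr a b c x y :
  same (mulnp a (mulnp b c)) x y = connect (glue4 a b c) (outer4 x) (outer4 y).
Proof.
pose e1 := relU (image_rel row23 b) (image_rel row34 c).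
pose K (u : point4) := if u is inl (inr _) then false else true.
pose g (u : point3) : point4 :=
  match u with inl (inl i) => inl (inl (inr i)) | inl (inr i) => inl (inr i)
             | inr i => inr i end.
have g_inj : injective g by case=> [[i|i]|i] [[j|j]|j] // [->].
have gu z : g (upper3 z) = row23 z by case: z.
have gl z : g (lower3 z) = row34 z by case: z.
have E1 p v : e1 (g p) v -> exists2 q, v = g q & connect (glue b c) p q.
  case/orP=> /image_relP[s [t []]].
    rewrite -!gu => /g_inj-> -> st; exists (upper3 t) => //.
    by apply/connect1/glueP; left; exists s, t.
  rewrite -!gl => /g_inj-> -> st; exists (lower3 t) => //.
  by apply/connect1/glueP; right; exists s, t.
have E1' p q : glue b c p q -> connect e1 (g p) (g q).
  case/glueP=> -[s [t [-> -> st]]]; apply/connect1/orP; [left | right];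
  by apply/image_relP; exists s, t; rewrite ?gu ?gl.
have E4 i v : connect e1 (inl (inl (inl i))) v -> v = inl (inl (inl i)).
  by case/connectP=> -[|w p] //= /andP[/orP[] /image_relP[[] ? [t []]]].
have -> : connect (glue4 a b c) =2 connect (relU e1 (image_rel row12 a)).
  by apply: eq_connect => u v; rewrite /glue4 /e1 /= -orbA orbC.
rewrite (@connect_restrict _ e1 _ K); first last.
- by case: y.
- by case: x.
- by move=> u v /image_relP[[] i [[] j [-> ->]]].
set e' := relU (SimplRel _) _.
pose f (u : point3) : point4 :=
  match u with inl p => inl (inl p) | inr i => inr i end.
have -> : outer4 x = f (outer3 x) by case: x.
have -> : outer4 y = f (outer3 y) by case: y.
rewrite same_mul /joined -(@connect_embed _ _ f (glue a (mulnp b c)) e') //.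
- by case=> [p|i] [q|j] // [->].
- move=> p q /glueP[] [s [t [-> -> st]]]; apply/connect1/orP.
    by right; apply/image_relP; exists s, t.
  left; have fE z : f (lower3 z) = g (outer3 z) by case: z.
  rewrite !fE; apply/and3P; split; [|by case: (s)|by case: (t)].
  by rewrite (connect_embed g_inj E1' E1); move: st; rewrite same_mul.
move=> p v /orP[/and3P[pv _ Kv]|/image_relP[s [t [pE -> st]]]]; last first.
  exists (upper3 t) => //.
  have -> : p = upper3 s by case: p pE => [z|i] // [->].
  by apply/connect1/glueP; left; exists s, t.
have [[z pE]|[i pE]] : (exists z, p = lower3 z) \/ exists i, p = inl (inl i).
  by case: (p) => [[i|i]|i]; [right; exists i | left; exists (inl i) | left; exists (inr i)].
  move: pv; have -> : f p = g (outer3 z) by rewrite pE; case: (z).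
  case/(connect_image E1)=> q vE zq.
  have [t tE]: exists t, q = outer3 t.
    by move: Kv; rewrite vE; case: (q) => [[i|//]|i] _; [exists (inl i) | exists (inr i)].
  exists (lower3 t); first by rewrite vE tE; case: (t).
  rewrite pE; apply/connect1/glueP; right; exists z, t; split=> //.
  by rewrite same_mul -tE.
move: pv; rewrite pE /= => /E4 ->; by exists (inl (inl i)).
Qed.

Lemma mulnpA : associative mulnp.
Proof. by move=> a b c; apply: npartition_inj => x y; rewrite mulnpAl mulnpAr. Qed.

End Product.

HB.instance Definition _ n := isMonoid.Build (npartition n)
  (@mulnpA n) (@mul1np n) (@mulnp1 n).

Section Motzkin.

Variable n : nat.
Implicit Types (a : npartition n) (A B : {set point n}) (x y : point n).

Definition transverse A :=
  [exists i, inl i \in A] && [exists i, inr i \in A].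

Definition rank a := #|[set A in blocks a | transverse A]|.

(** The position of a point in the order n' < ... < 1' < 1 < ... < n. *)
Definition position x : nat :=
  match x with inl i => n + i | inr i => rev_ord i end.

Definition crossing A B :=
  [exists x in A, exists y in A, exists u in B, exists v in B,
    [&& position x < position u, position u < position y
      & position y < position v]].

Definition planar a :=
  [forall A in blocks a, forall B in blocks a, (A != B) ==> ~~ crossing A B].

Definition motzkin : {set npartition n} :=
  [set a | planar a && [forall A in blocks a, #|A| <= 2]].

Definition Jrank (r : nat) : {set npartition n} := [set a | rank a == r].

Definition motzkin_nonid : {set npartition n} := motzkin :\ 1.

Definition motzkin_singletons (I : {set 'I_n}) : {set npartition n} :=
  (motzkin :\: Jrank n.-1)
  :|: (\bigcup_(i in I)
         [set a in motzkin | (rank a == n.-1) && ([set inl i] \in blocks a)]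
       :|: \bigcup_(i in ~: I)
         [set a in motzkin | (rank a == n.-1) && ([set inr i] \in blocks a)]).

(** The hooks {i, i+1} and {i', (i+1)'} are given by [i] and its successor [j]. *)
Definition motzkin_no_upper_hook (i j : 'I_n) : {set npartition n} :=
  motzkin :\: [set a in Jrank n.-2 | [set inl i; inl j] \in blocks a].

Definition motzkin_no_lower_hook (i j : 'I_n) : {set npartition n} :=
  motzkin :\: [set a in Jrank n.-2 | [set inr i; inr j] \in blocks a].

End Motzkin.

(* Main.v *)
Require Import Defs.
From mathcomp Require Import all_boot perm zify.

(** The proof works with the relation [same a x y], saying that [x] and [y] lie in
    the same block of [a].

    That the Motzkin elements are closed under products rests on two facts about
    the product graph. Blocks of a product have at most two points because every
    vertex of the graph has at most two neighbours, so a component is a path or a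
    cycle and contains at most two of the end points in the outer rows
    ([leaves3], [small_mul]). Planarity is preserved because of a Jordan-curve
    argument modulo 2: each walk between two outer points separates the points of
    the three rows into two sides, and a block of either factor that is disjoint
    from the walk stays on one side ([winding], [noncrossing_mul]).

    A submonoid of the Motzkin monoid is everything as soon as it contains all
    elements of rank n-1 and, for each pair of consecutive points, one element of
    rank n-2 having that pair as an upper hook and one having it as a lower hook,
    a hook being a block of two points in the same row ([motzkin_generated]). The elements of rank n-1 generate all order-preserving
    partial injections; multiplying by these turns one short hook into a hook of
    any length, with nothing but singletons underneath; peeling off innermost hooks
    one at a time then produces every element without lower hooks. By the flip
    anti-automorphism every element without upper hooks is produced as well, and
    each Motzkin element is a product of one of each kind.

    Hence a proper subsemigroup that is contained in none of the sets (a), (c), (d)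
    misses an element of rank n-1. The elements of rank n-1 are the pairs (i, j) of
    an upper and a lower singleton, and they multiply as matrix units do, so those
    lying in the subsemigroup form a transitive relation on the n points that is
    not full. For a suitable point p, the points other than p that are not reached
    from p make up the set A of case (b) ([proper_sub_member]). Since the sets of
    the four kinds are proper subsemigroups ([member_proper]), none of which
    contains another ([missing_inj]), they are exactly the maximal ones
    ([maximal_motzkin]). *)

Set Implicit Arguments.
Unset Strict Implicit.
Unset Printing Implicit Defensive.

(** * Blocks and planarity *)

Section Same.
Variable n : nat.
Implicit Types (a b c : npartition n) (x y z u v : point n).

Lemma same_sym a x y : same a x y = same a y x.
Proof. by rewrite !same_pblockE eq_sym. Qed.

Lemma same_trans a x y z : same a x y -> same a y z -> same a x z.
Proof. by rewrite !same_pblockE => /eqP->. Qed.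

Lemma position_inj : injective (@position n).
Proof.
move=> [i|i] [j|j] /=; have := ltn_ord i; have := ltn_ord j => hj hi h;
  first [by congr inl; apply/val_inj => /=; lia | by congr inr; apply/val_inj => /=; lia | lia].
Qed.

(** Exactly one of [u] and [v] lies strictly below [x]. For [x] distinct from both,
    this says that [x] is strictly between them. *)
Definition btw (u v x : nat) := (u < x) (+) (v < x).

(** Every block has at most two points. *)
Definition small a := forall x y z,
  same a x y -> same a x z -> x != y -> x != z -> y = z.

(** No block separates two points of another block: the form of planarity that is
    additive modulo 2 along walks. *)
Definition noncrossing a := forall x y u v,
  same a x y -> same a u v -> ~~ same a x u ->
  btw (position u) (position v) (position x)
  = btw (position u) (position v) (position y).

Lemma planarP a : reflect (noncrossing a) (planar a).
Proof.
apply: (iffP idP) => [pl x y u v xy uv xu | nc].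
  have H x' y' u' v' : same a x' y' -> same a u' v' -> ~~ same a x' u' ->
      ~~ [&& position x' < position u', position u' < position y'
      & position y' < position v'].
    move=> xy' uv' xu'; move/forall_inP: pl => /(_ (pblock a x')).
    have cov w : w \in cover (blocks a) by rewrite (cover_partition (blocksP a)) inE.
    move=> /(_ (pblock_mem (cov _)))/forall_inP/(_ (pblock a u') (pblock_mem (cov _))).
    rewrite -same_pblockE xu' /=; apply: contra => h.
    apply/exists_inP; exists x'; first exact: samexx.
    apply/exists_inP; exists y' => //.
    apply/exists_inP; exists u'; first exact: samexx.
    by apply/exists_inP; exists v'.
  have yx : same a y x by rewrite same_sym.
  have vu : same a v u by rewrite same_sym.
  have xv : ~~ same a x v by apply: contra xu => /same_trans; apply.
  have yu : ~~ same a y u by apply: contra xu; apply: same_trans.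
  have yv : ~~ same a y v by apply: contra xv; apply: same_trans.
  have [ux vx uy vy]: [/\ ~~ same a u x, ~~ same a v x, ~~ same a u y & ~~ same a v y].
    by rewrite ![same a u _]same_sym ![same a v _]same_sym.
  have D s t : ~~ same a s t -> position s != position t.
    by apply: contra => /eqP/position_inj->; apply: samexx.
  move: (H _ _ _ _ xy uv xu) (H _ _ _ _ xy vu xv) (H _ _ _ _ yx uv yu) (H _ _ _ _ yx vu yv)
     (H _ _ _ _ uv xy ux) (H _ _ _ _ uv yx uy) (H _ _ _ _ vu xy vx) (H _ _ _ _ vu yx vy)
     (D _ _ xu) (D _ _ xv) (D _ _ yu) (D _ _ yv).
  rewrite /btw; move: (position x) (position y) (position u) (position v) => p q r s.
  by case: (ltngtP r p) => ?; case: (ltngtP s p) => ?; case: (ltngtP r q) => ?;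
     case: (ltngtP s q) => ? //=; lia.
apply/forall_inP => A aA; apply/forall_inP => B aB; apply/implyP => AB.
apply/negP => /exists_inP[x xA] /exists_inP[y yA] /exists_inP[u uB] /exists_inP[v].
move=> vB /and3P[xu uy yv].
have /and3P[_ tI _] := blocksP a.
have xy : same a x y by apply/Defs.sameP; exists A.
have uv : same a u v by apply/Defs.sameP; exists B.
have xNu : ~~ same a x u.
  apply: contra AB => /Defs.sameP[C [aC xC uC]].
  by rewrite -(def_pblock tI aA xA) -(def_pblock tI aB uB) (def_pblock tI aC xC) (def_pblock tI aC uC).
by have := nc _ _ _ _ xy uv xNu; rewrite /btw; lia.
Qed.

Lemma smallP a : reflect (small a) [forall A in blocks a, #|A| <= 2].
Proof.
apply: (iffP forall_inP) => [sz x y z xy xz nxy nxz | sm A aA].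
  have cov w : w \in cover (blocks a) by rewrite (cover_partition (blocksP a)) inE.
  have := sz _ (pblock_mem (cov x)); apply: contraTeq => yz; rewrite -ltnNge.
  have /subset_leq_card : [set x; y; z] \subset pblock a x.
    apply/subsetP=> w; rewrite !inE => /orP[/orP[]|] /eqP-> //.
    exact: samexx.
  apply: leq_trans; rewrite setUC cardsU1 cards2 !inE nxy.
  by rewrite ![z == _]eq_sym (negbTE nxz) (negbTE yz).
rewrite leqNgt; apply/negP => /card_gt2P[x [y [z [[xA yA zA] [xy yz zx]]]]].
have S u v : u \in A -> v \in A -> same a u v by move=> uA vA; apply/Defs.sameP; exists A.
by have := sm x y z (S _ _ xA yA) (S _ _ xA zA) xy; rewrite eq_sym => /(_ zx) E; rewrite E eqxx in yz.
Qed.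

Lemma motzkinP a : reflect (noncrossing a /\ small a) (a \in motzkin n).
Proof.
by rewrite inE; apply: (iffP andP) => -[/planarP h /smallP k].
Qed.

End Same.

(** * Connected leaves in graphs of degree at most two *)

Section Leaves.
Variables (V : finType) (e : rel V).
Hypothesis e_sym : symmetric e.
Hypothesis deg2 : forall w x y z,
  e w x -> e w y -> e w z -> x != y -> x != z -> y = z.
(** A vertex with at most one neighbour. *)
Definition leaf x := forall y z, e x y -> e x z -> y = z.

(* Two simple paths that arrive at [w] from [pr] are forced to follow each other,
   and a leaf can only be the last vertex of both. *)
Let same_end w pr p q : e w pr -> path e w p -> path e w q ->
  uniq (pr :: w :: p) -> uniq (pr :: w :: q) ->
  leaf (last w p) -> leaf (last w q) -> last w p = last w q.
Proof.
elim: p w pr q => [|c p IH] w pr [|d q] //= wpr.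
- move=> _ /andP[wd _] _ /andP[prn _] /(_ _ _ wpr wd) E.
  by rewrite E !inE eqxx orbT in prn.
- move=> /andP[wd _] _ /andP[prn _] _ _ /(_ _ _ wpr wd) E.
  by rewrite E !inE eqxx orbT in prn.
move=> /andP[wc cp] /andP[wd dq].
rewrite !inE !negb_or -!andbA => /and5P[prw prc prp wc' /and3P[wp cp' up]].
case/and5P=> _ prd prq wd' /and3P[wq dq' uq].
have E := deg2 wpr wc wd prc prd; subst d.
by apply: (IH c w q); rewrite ?cp ?dq //= ?inE ?negb_or ?wc' ?wp ?wq ?cp' ?dq' ?up ?uq // e_sym.
Qed.

(** A component has at most two leaves. *)
Lemma leaves3 x y z : leaf x -> leaf y -> leaf z ->
  connect e x y -> connect e x z -> x != y -> x != z -> y = z.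
Proof.
move=> lx ly lz /connectP[p0 xp0 yE] /connectP[q0 xq0 zE]; subst y z.
move: ly lz; case/shortenP: xp0 => p xp up _; case/shortenP: xq0 => q xq uq _.
case: p xp up => [|c p] /=; first by rewrite eqxx.
case: q xq uq => [|d q] /=; first by rewrite eqxx.
move=> /andP[xd dq] uq /andP[xc cp] up lp lq _ _.
have E := lx _ _ xc xd; subst d.
by apply: (same_end (pr := x)) => //; rewrite e_sym.
Qed.

End Leaves.

(** * Products of Motzkin elements *)

Section Closure.
Variable n : nat.
Implicit Types (a b c : npartition n) (x y z : point n) (u v : point3 n).

Lemma joined_sym a b u v : joined a b u v = joined a b v u.
Proof. exact: (sym_connect_sym (@glue_sym _ a b)). Qed.

Lemma joinedxx a b u : joined a b u u.
Proof. exact: connect0. Qed.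

Lemma joined_trans a b u v w : joined a b u v -> joined a b v w -> joined a b u w.
Proof. exact: connect_trans. Qed.

Lemma joined_upper a b x y : same a x y -> joined a b (upper3 x) (upper3 y).
Proof. by move=> xy; apply/connect1/glueP; left; exists x, y. Qed.

Lemma joined_lower a b x y : same b x y -> joined a b (lower3 x) (lower3 y).
Proof. by move=> xy; apply/connect1/glueP; right; exists x, y. Qed.

Lemma upper3_inj : injective (@upper3 n).
Proof. by move=> x y []. Qed.

Lemma lower3_inj : injective (@lower3 n).
Proof. by move=> [] i [] j // []->. Qed.

Lemma outer3_inj : injective (@outer3 n).
Proof. by move=> [] i [] j // []->. Qed.

Lemma small_mul a b : small a -> small b -> small (mulnp a b).
Proof.
move=> sa sb x y z; rewrite !same_mul => xy xz nxy nxz.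
(* [glue] is reflexive; degrees are counted in the loopless graph [e]. *)
pose e : rel (point3 n) := fun u v => glue a b u v && (u != v).
have cE : joined a b =2 connect e.
  move=> u v; apply/idP/idP; last by apply: connect_sub => s t /andP[st _]; apply: connect1.
  apply: connect_sub => s t st; have [->|ne] := eqVneq s t; first exact: connect0.
  by apply: connect1; rewrite /e st.
have eE u v : reflect
    ((exists x y, [/\ u = upper3 x, v = upper3 y, same a x y & x != y]) \/
     (exists x y, [/\ u = lower3 x, v = lower3 y, same b x y & x != y])) (e u v).
  apply: (iffP andP) => [[/glueP[] [s [t [-> -> st]]]] ne|[][s [t [-> -> st ne]]]].
  - by left; exists s, t; split=> //; apply: contra ne => /eqP->.
  - by right; exists s, t; split=> //; apply: contra ne => /eqP->.
  - by split; [apply/glueP; left; exists s, t | rewrite (inj_eq upper3_inj)].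
  - by split; [apply/glueP; right; exists s, t | rewrite (inj_eq lower3_inj)].
have esym : symmetric e.
  by move=> u v; rewrite /e glue_sym eq_sym.
have lf s : leaf e (outer3 s).
  move=> u v; case: s => i.
  - move=> /eE[] [s [t [/= + -> st ne]]]; last by case: s st ne.
    move=> [E] /eE[] [s' [t' [/= + -> st' ne']]]; last by case: s' st' ne'.
    move=> [E']; subst s s'; congr upper3; exact: sa st st' ne ne'.
  - move=> /eE[] [s [t [/= + -> st ne]]] //; case: s st ne => // s st ne.
    move=> [E] /eE[] [s' [t' [/= + -> st' ne']]] //; case: s' st' ne' => // s' st' ne'.
    move=> [E']; subst s s'; congr lower3; exact: sb st st' ne ne'.
apply/outer3_inj/(leaves3 esym _ (lf x) (lf y) (lf z)); rewrite -?cE ?(inj_eq outer3_inj) //.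
move=> w u1 u2 u3 /eE E1 /eE E2 /eE E3 n12 n13.
(* Of three neighbours of [w], two are reached through the same factor. *)
have A1 u v : (exists x y, [/\ w = upper3 x, u = upper3 y, same a x y & x != y]) ->
   (exists x y, [/\ w = upper3 x, v = upper3 y, same a x y & x != y]) -> u = v.
  move=> [s [t [-> -> st ne]]] [s' [t' [/upper3_inj <- -> st' ne']]].
  by congr upper3; exact: sa st st' ne ne'.
have A2 u v : (exists x y, [/\ w = lower3 x, u = lower3 y, same b x y & x != y]) ->
   (exists x y, [/\ w = lower3 x, v = lower3 y, same b x y & x != y]) -> u = v.
  move=> [s [t [-> -> st ne]]] [s' [t' [/lower3_inj <- -> st' ne']]].
  by congr lower3; exact: sb st st' ne ne'.
case: E1 E2 E3 => E1 [] E2 [] E3; first [exact: A1 E2 E3 | exact: A2 E2 E3 |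
  by rewrite (A1 _ _ E1 E2) eqxx in n12 | by rewrite (A2 _ _ E1 E2) eqxx in n12
  | by rewrite (A1 _ _ E1 E3) eqxx in n13 | by rewrite (A2 _ _ E1 E3) eqxx in n13].
Qed.

End Closure.

Section Winding.
Variable n : nat.
Implicit Types (a b c : npartition n) (x y z : point n) (s t u v : point3 n).

(** Whether the vertex [s] lies below the viewer [z] in the part of the picture that
    matters for [z]: the order of the first factor for an upper viewer, of the second
    factor for a lower one. For a middle viewer, which sees both orders, the value is
    chosen so that the changes along the edges of both factors add up to it. *)
Definition below s (z : point3 n) : bool :=
  match z, s with
  | inl (inl i), inl (inl k) => k < i
  | inl (inl i), _ => true
  | inl (inr i), inl (inr k) => i < k
  | inr i, inr k => i < k
  | _, _ => false
  end.

(** For a walk from [u] to [v], [wa x] counts modulo 2 the edges of the walk in the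
    first factor whose ends lie on different sides of the point [x] of that factor, and
    [wb] does the same in the second factor. Both are constant on the blocks that the walk
    does not meet, and on each row the count telescopes to the end points. *)
Lemma winding a b u v : noncrossing a -> noncrossing b -> joined a b u v ->
  exists wa wb : point n -> bool, [/\
    forall x y, same a x y -> ~~ joined a b u (upper3 x) -> wa x = wa y,
    forall x y, same b x y -> ~~ joined a b u (lower3 x) -> wb x = wb y,
    forall i, wa (inl i) = below u (inl (inl i)) (+) below v (inl (inl i)),
    forall i, ~~ joined a b u (inl (inr i)) ->
      wa (inr i) (+) wb (inl i) = below u (inl (inr i)) (+) below v (inl (inr i)) &
    forall i, wb (inr i) = below u (inr i) (+) below v (inr i)].
Proof.
move=> nca ncb /connectP[p up ->{v}].
elim: p u up => [|w p IH] u /=.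
  by exists xpred0, xpred0; split=> *; rewrite ?addbb.
case/andP=> uw /[dup] wp /IH[wa [wb [Ha Hb Hu Hm Hl]]].
have jE t : joined a b w t = joined a b u t.
  by rewrite /joined (same_connect (sym_connect_sym (@glue_sym n a b)) (connect1 uw)).
have wt : joined a b w w by apply: joinedxx.
have ut : joined a b u u by apply: joinedxx.
case/glueP: uw => -[s [t [uE wE st]]].
  exists (fun x => wa x (+) btw (position s) (position t) (position x)), wb; split=> //.
  - move=> x y xy ux; congr (_ (+) _); first by apply: Ha; rewrite ?jE.
    rewrite /btw; apply: (nca _ _ _ _ xy st).
    by apply: contra ux => /(joined_upper b); rewrite joined_sym uE.
  - by move=> x y xy ux; apply: Hb; rewrite ?jE.
  - move=> i; rewrite Hu uE wE /btw /=.
    move: s t {st uE wE} => [k|k] [l|l] /=; rewrite ?ltn_add2l;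
      have := ltn_ord k; have := ltn_ord l; lia.
  - move=> i ui; move: (Hm i); rewrite jE => /(_ ui); rewrite uE wE /btw => E.
    rewrite addbAC E /=.
    by move: s t {st uE wE E} => [k|k] [l|l] /=; rewrite ?ltn_add2l;
      have := ltn_ord k; have := ltn_ord l; have := ltn_ord i; lia.
  - by move=> i; rewrite Hl uE wE.
exists wa, (fun x => wb x (+) btw (position s) (position t) (position x)); split=> //.
- by move=> x y xy ux; apply: Ha; rewrite ?jE.
- move=> x y xy ux; congr (_ (+) _); first by apply: Hb; rewrite ?jE.
  rewrite /btw; apply: (ncb _ _ _ _ xy st).
  by apply: contra ux => /(joined_lower a); rewrite joined_sym uE.
- by move=> i; rewrite Hu uE wE; move: s t {st uE wE} => [k|k] [l|l] /=.
- move=> i ui; move: (Hm i); rewrite jE => /(_ ui); rewrite uE wE /btw => E.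
  rewrite addbA E /=.
  have Ni k : joined a b u (lower3 (inl k)) -> k != i :> nat.
    by apply: contraL => /eqP/val_inj->.
  have us : joined a b u (lower3 s) by rewrite -uE.
  have {}ut : joined a b u (lower3 t) by rewrite -wE -jE.
  by move: s t us ut {st uE wE E} => [k|k] [l|l] => [/Ni ? /Ni ?|/Ni ? _|_ /Ni ?|_ _] /=;
    rewrite ?ltn_add2l; have := ltn_ord k; have := ltn_ord l; have := ltn_ord i; lia.
- move=> i; rewrite Hl uE wE /btw.
  by move: s t {st uE wE} => [k|k] [l|l] /=;
    have := ltn_ord k; have := ltn_ord l; have := ltn_ord i; lia.
Qed.

Lemma noncrossing_mul a b :
  noncrossing a -> noncrossing b -> noncrossing (mulnp a b).
Proof.
move=> nca ncb x y u v; rewrite !same_mul => xy uv xu.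
have [wa [wb [Ha Hb Hu Hm Hl]]] := winding nca ncb uv.
(* [f] is the side of the walk from [u] to [v]. The two counts agree on the middle
   row, as [u] and [v] are outer points. *)
pose f s := match s with inl x => wa x | inr i => wb (inr i) end.
have fl z : ~~ joined a b (outer3 u) (lower3 z) -> f (lower3 z) = wb z.
  case: z => //= i /Hm; move: u v {xu uv Ha Hb Hu Hm Hl} => [u|u] [v|v] /=;
  by move: (wa _) (wb _) => [] [].
have fo z : f (outer3 z) = btw (position u) (position v) (position z).
  rewrite /btw; move: u v z {xu uv Ha Hb Hm fl xy} Hu Hl => [u|u] [v|v] [i|i] /= Hu Hl;
  rewrite ?Hu ?Hl /=; have := ltn_ord u; have := ltn_ord v; have := ltn_ord i; lia.
rewrite -!fo; move: xu; rewrite joined_sym; case/connectP: xy => p xp ->.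
elim: p (outer3 x) xp => //= w p IH s /andP[sw wp] us.
have uw : ~~ joined a b (outer3 u) w.
  apply: contra us => /joined_trans; apply; rewrite joined_sym; exact: connect1.
rewrite -(IH _ wp uw); case/glueP: sw => -[s' [t [sE wE st]]].
  by rewrite sE wE /=; apply: Ha; rewrite -?sE.
by rewrite sE wE !fl -?sE -?wE //; apply: Hb; rewrite -?sE.
Qed.

Lemma motzkin_mul a b : a \in motzkin n -> b \in motzkin n -> (a * b)%g \in motzkin n.
Proof.
move=> /motzkinP[ca sa] /motzkinP[cb sb]; apply/motzkinP.
by split; [apply: noncrossing_mul | apply: small_mul].
Qed.

Lemma motzkin_one : 1%g \in motzkin n.
Proof.
apply/motzkinP; split.
  move=> [x|x] [y|y] [u|u] [v|v]; rewrite !same_one /= => /eqP-> /eqP-> ne //;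
  rewrite /btw /=; have := ltn_ord u; have := ltn_ord v; have := ltn_ord x;
  have := ltn_ord y; move: ne; rewrite -val_eqE /=; lia.
by move=> [x|x] [y|y] [z|z]; rewrite !same_one /= => /eqP-> /eqP-> //; rewrite eqxx.
Qed.

End Winding.

(** * Flip, domain, codomain and rank *)

Section Build.
Variable n : nat.
Implicit Types (a b c : npartition n) (x y z : point n).

Lemma of_rel_subproof (e : rel (point n)) :
  equivalence_rel e -> {in [set: point n] & &, equivalence_rel e}.
Proof. by move=> h x y z _ _ _; apply: h. Qed.

(** The partition into the classes of an equivalence relation. *)
Definition of_rel (e : rel (point n)) (h : equivalence_rel e) : npartition n :=
  NPartition (equivalence_partitionP (of_rel_subproof h)).

Lemma same_of_rel e (h : equivalence_rel e) x y : same (of_rel h) x y = e x y.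
Proof. by rewrite /same (pblock_equivalence_partition (of_rel_subproof h)) ?inE. Qed.

Definition swap x : point n := match x with inl i => inr i | inr i => inl i end.

Lemma swapK : involutive swap.
Proof. by case. Qed.

Lemma flip_subproof a : equivalence_rel (fun x y => same a (swap x) (swap y)).
Proof.
move=> x y z; split; first exact: samexx.
by rewrite !same_pblockE => /eqP->.
Qed.

(** The anti-automorphism that turns a partition upside down. *)
Definition flip a := of_rel (flip_subproof a).

Lemma same_flip a x y : same (flip a) x y = same a (swap x) (swap y).
Proof. exact: same_of_rel. Qed.

Lemma flipK : involutive flip.
Proof. by move=> a; apply: npartition_inj => x y; rewrite !same_flip !swapK. Qed.

Lemma flip1 : flip 1%g = 1%g.
Proof.
by apply: npartition_inj => x y; rewrite same_flip !same_one; case: x y => i [].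
Qed.

Lemma flipM a b : flip (a * b)%g = (flip b * flip a)%g.
Proof.
apply: npartition_inj => x y; rewrite same_flip !same_mul.
pose f (u : point3 n) : point3 n := match u with
  | inl (inl i) => inr i | inl (inr i) => inl (inr i) | inr i => inl (inl i) end.
have fK : involutive f by case=> [[]|].
have fo z : outer3 (swap z) = f (outer3 z) by case: z.
have fu z : upper3 (swap z) = f (lower3 z) by case: z.
have fl z : lower3 (swap z) = f (upper3 z) by case: z.
have fu' z : f (upper3 z) = lower3 (swap z) by case: z.
have fl' z : f (lower3 z) = upper3 (swap z) by case: z.
have gl s t : glue (flip b) (flip a) s t = glue a b (f s) (f t).
  apply/glueP/glueP => -[] [x' [y' [sE tE st]]].
  - by right; exists (swap x'), (swap y'); rewrite -same_flip sE tE !fl.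
  - by left; exists (swap x'), (swap y'); rewrite -same_flip sE tE !fu.
  - by right; exists (swap x'), (swap y'); rewrite same_flip !swapK -(fK s) -(fK t) sE tE !fu'.
  - by left; exists (swap x'), (swap y'); rewrite same_flip !swapK -(fK s) -(fK t) sE tE !fl'.
rewrite !fo /joined; apply: connect_embed (can_inj fK) _ _ _ _ => [s t|s t].
  by rewrite gl; apply: connect1.
by move=> st; exists (f t); rewrite ?fK //; apply: connect1; rewrite gl fK.
Qed.

Lemma flip_motzkin a : (flip a \in motzkin n) = (a \in motzkin n).
Proof.
suff h b : b \in motzkin n -> flip b \in motzkin n.
  by apply/idP/idP => /h //; rewrite flipK.
move=> /motzkinP[nc sm]; apply/motzkinP; split.
  move=> x y u v; rewrite !same_flip => xy uv xu.
  have pE z : position (swap z) = n.*2.-1 - position z.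
    by case: z => i /=; have := ltn_ord i; lia.
  have pb z : position z < n.*2 by case: z => i /=; have := ltn_ord i; lia.
  have D s t : ~~ same b (swap s) (swap t) -> position s != position t.
    by apply: contra => /eqP/position_inj->; apply: samexx.
  have xv : ~~ same b (swap x) (swap v).
    by apply: contra xu => /same_trans; apply; rewrite same_sym.
  have yu : ~~ same b (swap y) (swap u) by apply: contra xu; apply: same_trans.
  have yv : ~~ same b (swap y) (swap v) by apply: contra xv; apply: same_trans.
  have := nc _ _ _ _ xy uv xu; rewrite /btw !pE.
  move: (pb x) (pb y) (pb u) (pb v) (D _ _ xu) (D _ _ xv) (D _ _ yu) (D _ _ yv).
  move: (position x) (position y) (position u) (position v) => p q r s.
  by case: (ltngtP r p) => ?; case: (ltngtP s p) => ?; case: (ltngtP r q) => ?;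
     case: (ltngtP s q) => ? //=; lia.
move=> x y z; rewrite !same_flip => xy xz nxy nxz; apply: (can_inj swapK).
by apply: sm xy xz _ _; rewrite (inj_eq (can_inj swapK)).
Qed.

(** The upper points, respectively the lower points, on transverse blocks. *)
Definition dom a := [set i | [exists j, same a (inl i) (inr j)]].
Definition cod a := [set j | [exists i, same a (inl i) (inr j)]].

Lemma domP a i : reflect (exists j, same a (inl i) (inr j)) (i \in dom a).
Proof. by rewrite inE; apply: existsP. Qed.

Lemma codP a j : reflect (exists i, same a (inl i) (inr j)) (j \in cod a).
Proof. by rewrite inE; apply: existsP. Qed.

Lemma same_dom a i j : same a (inl i) (inr j) -> i \in dom a.
Proof. by move=> ij; apply/domP; exists j. Qed.

Lemma same_cod a i j : same a (inl i) (inr j) -> j \in cod a.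
Proof. by move=> ij; apply/codP; exists i. Qed.

Lemma dom_flip a : dom (flip a) = cod a.
Proof.
by apply/setP=> i; rewrite !inE; apply: eq_existsb => j; rewrite same_flip same_sym.
Qed.

Lemma cod_flip a : cod (flip a) = dom a.
Proof. by rewrite -{2}(flipK a) dom_flip. Qed.

Lemma dom1 : dom (1%g : npartition n) = setT.
Proof. by apply/setP=> i; rewrite !inE; apply/existsP; exists i; rewrite same_one /=. Qed.

Lemma small_lower a i j k : small a ->
  same a (inl i) (inr j) -> same a (inl i) (inr k) -> j = k.
Proof. by move=> sm ij ik; apply: (@inr_inj 'I_n); apply: sm ij ik _ _. Qed.

Lemma small_dom a i x k : small a -> same a (inl i) (inr k) -> same a (inl i) x ->
  x = inl i \/ x = inr k.
Proof.
move=> sm ik ix; have [->|ne] := eqVneq x (inl i); first by left.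
by right; apply/esym/(sm (inl i)) => //; rewrite eq_sym.
Qed.

Lemma small_cod a k x j : small a -> same a (inl j) (inr k) -> same a (inr k) x ->
  x = inr k \/ x = inl j.
Proof.
move=> sm jk kx; have [->|ne] := eqVneq x (inr k); first by left.
by right; apply/esym/(sm (inr k)) => //; [rewrite same_sym | rewrite eq_sym].
Qed.

Lemma small_upper a i j k : small a ->
  same a (inl i) (inr k) -> same a (inl j) (inr k) -> i = j.
Proof.
move=> sm ik; rewrite same_sym => kj.
by case: (small_dom sm ik (same_trans ik kj)) => // -[].
Qed.

Lemma small_dom_upper a i j : small a -> i \in dom a -> same a (inl i) (inl j) -> i = j.
Proof. by move=> sm /domP[k ik] /(small_dom sm ik) [] // [->]. Qed.

Lemma small_cod_lower a i j : small a -> i \in cod a -> same a (inr i) (inr j) -> i = j.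
Proof. by move=> sm /codP[k ik] /(small_cod sm ik) [] // [->]. Qed.

Let card_blocks a (g : 'I_n -> point n) (D : {set 'I_n}) :
  {in D, forall i j, same a (g i) (g j) -> i = j} ->
  [set A in blocks a | transverse A] = [set pblock a (g i) | i in D] -> rank a = #|D|.
Proof.
move=> inj E; rewrite /rank E card_in_imset // => i j iD _ /eqP.
by rewrite -same_pblockE; apply: inj.
Qed.

Lemma rank_dom a : small a -> rank a = #|dom a|.
Proof.
move=> sm; apply: (card_blocks (a := a) (g := inl)) => [i iD j|]; first exact: small_dom_upper.
have /and3P[_ tI _] := blocksP a.
have cov w : w \in cover (blocks a) by rewrite (cover_partition (blocksP a)) inE.
apply/setP=> A; rewrite !inE; apply/andP/imsetP => [[aA /andP[]]|[i /domP[j ij] ->]].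
  move=> /existsP[i iA] /existsP[j jA]; exists i; last by rewrite (def_pblock tI aA iA).
  by apply/domP; exists j; apply/Defs.sameP; exists A.
split; first exact: pblock_mem.
by apply/andP; split; apply/existsP; [exists i | exists j] => //; apply: samexx.
Qed.

Lemma rank_cod a : small a -> rank a = #|cod a|.
Proof.
move=> sm; apply: (card_blocks (a := a) (g := inr)) => [i iD j|]; first exact: small_cod_lower.
have /and3P[_ tI _] := blocksP a.
have cov w : w \in cover (blocks a) by rewrite (cover_partition (blocksP a)) inE.
apply/setP=> A; rewrite !inE; apply/andP/imsetP => [[aA /andP[]]|[j /codP[i ij] ->]].
  move=> /existsP[i iA] /existsP[j jA]; exists j; last by rewrite (def_pblock tI aA jA).
  by apply/codP; exists i; apply/Defs.sameP; exists A.
split; first exact: pblock_mem.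
rewrite same_sym in ij.
by apply/andP; split; apply/existsP; [exists i | exists j] => //; apply: samexx.
Qed.

Lemma card_dom_cod a : small a -> #|dom a| = #|cod a|.
Proof. by move=> sm; rewrite -rank_dom // rank_cod. Qed.

Lemma rank_flip a : small a -> small (flip a) -> rank (flip a) = rank a.
Proof. by move=> sm sf; rewrite rank_dom // dom_flip rank_cod. Qed.

Lemma noncrossing_monotone a i i' j j' : noncrossing a -> small a ->
  same a (inl i) (inr j) -> same a (inl i') (inr j') -> i < i' -> j < j'.
Proof.
move=> nc sm ij ij' lt_i.
have ii' : ~~ same a (inl i) (inl i').
  by apply/negP=> /(small_dom_upper sm (same_dom ij)) E; rewrite E ltnn in lt_i.
have := nc _ _ _ _ ij ij' ii'; rewrite /btw /=.
have jj' : j != j' :> nat.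
  by apply: contraNneq ii' => /val_inj E; apply: (same_trans ij); rewrite same_sym E.
by have := ltn_ord j; have := ltn_ord j'; lia.
Qed.

(** A Motzkin element whose domain and codomain agree joins each point of them to its own
    copy, as an order-preserving permutation of a finite set is the identity. *)
Lemma dom_cod_id a i j : a \in motzkin n -> dom a = cod a ->
  same a (inl i) (inr j) -> i = j.
Proof.
case/motzkinP=> nc sm dc.
have [m] := ubnP i; elim: m i j => // m IH i j le_im ij.
have lt_ne : j < i -> i = j.
  move=> lt_ji; have : j \in dom a by rewrite dc (same_cod ij).
  case/domP=> k jk; have E := IH _ _ (leq_trans lt_ji le_im) jk; subst k.
  exact: small_upper ij jk.
case: (ltngtP i j) => [lt_ij|//|/val_inj //].
have : i \in cod a by rewrite -dc (same_dom ij).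
case/codP=> k ki; case: (ltngtP k i) => [lt_ki|lt_ik|/val_inj E].
- have E := IH _ _ (leq_trans lt_ki le_im) ki; by rewrite E ltnn in lt_ki.
- by have := noncrossing_monotone nc sm ij ki lt_ik; rewrite ltnNge ltnW.
- by rewrite E in ki; apply: small_lower ki ij.
Qed.

(** The identity is the only Motzkin element of rank n. *)
Lemma motzkin_rank_n a : a \in motzkin n -> dom a = setT -> a = 1%g.
Proof.
move=> aM dT; have [_ sm] := motzkinP _ aM.
have cT : cod a = setT.
  by apply/eqP; rewrite eqEcard subsetT -card_dom_cod // dT leqnn.
have tr i : same a (inl i) (inr i).
  have : i \in dom a by rewrite dT.
  by case/domP=> j ij; rewrite {2}(dom_cod_id aM _ ij) // dT.
apply: npartition_inj => x y; rewrite same_one.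
have U i j : same a (inl i) (inr j) = (i == j).
  by apply/idP/eqP => [ij|<- //]; apply: small_lower (tr i) ij.
case: x y => i [] j /=; rewrite ?U //.
- by apply/idP/eqP => [|->]; [apply: small_dom_upper; rewrite ?dT | apply: samexx].
- by rewrite same_sym U eq_sym.
- by apply/idP/eqP => [|->]; [apply: small_cod_lower; rewrite ?cT | apply: samexx].
Qed.

End Build.

(** * Products in which one factor has no hooks in the middle row *)

Section Products.
Variable n : nat.
Implicit Types (a b c : npartition n) (x y z : point n).

Lemma mul_upper_sub a b i j : same a (inl i) (inl j) -> same (a * b)%g (inl i) (inl j).
Proof. by rewrite same_mul; apply: joined_upper. Qed.

(** A product does not change the upper blocks of its first factor. *)
Lemma mul_upper a b i y : i \notin dom a ->
  same (a * b)%g (inl i) y = same a (inl i) y.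
Proof.
move=> iD; apply/idP/idP; last first.
  case: y => j ij; first exact: mul_upper_sub.
  by rewrite (same_dom ij) in iD.
rewrite same_mul => /connectP[p ip yE].
have H k : same a (inl i) (inl k) -> path (glue a b) (inl (inl k)) p ->
    exists2 j, last (inl (inl k)) p = inl (inl j) & same a (inl i) (inl j).
  elim: p k {ip yE} => [|w p IH] k ik /=; first by exists k.
  case/andP=> /glueP[] [s [t [sE wE st]]]; last by case: s sE {st}.
  move: s t sE wE st => [s|s] [t|t] // [<-] -> kt.
    by move=> /IH; apply; apply: same_trans kt.
  by rewrite (same_dom (same_trans ik kt)) in iD.
have [j yE' ij] := H _ (samexx a (inl i)) ip.
by move: yE; rewrite yE'; case: (y) => //= k [->].
Qed.

Lemma dom_mul a b : dom (a * b)%g \subset dom a.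
Proof.
apply/subsetP=> i /domP[j ij]; apply: contraLR ij => iD; rewrite mul_upper //.
by apply: contra iD => /same_dom.
Qed.

Lemma cod_mul a b : cod (a * b)%g \subset cod b.
Proof. by rewrite -!dom_flip flipM; apply: dom_mul. Qed.

Lemma mul_trans a b i k j :
  same a (inl i) (inr k) -> same b (inl k) (inr j) -> same (a * b)%g (inl i) (inr j).
Proof.
by rewrite same_mul => /(joined_upper b) ik /(joined_lower a) kj; apply: joined_trans ik kj.
Qed.

(** Two distinct lower, respectively upper, points never share a block. *)
Definition no_lower_hook a := forall i j, same a (inr i) (inr j) -> i = j.
Definition no_upper_hook a := forall i j, same a (inl i) (inl j) -> i = j.

Lemma no_lower_hook_flip a : no_upper_hook a -> no_lower_hook (flip a).
Proof. by move=> h i j; rewrite same_flip; apply: h. Qed.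

Lemma no_upper_hook_flip a : no_lower_hook a -> no_upper_hook (flip a).
Proof. by move=> h i j; rewrite same_flip; apply: h. Qed.

Section NoLowerHook.
Variables a b : npartition n.
Hypothesis ha : no_lower_hook a.

(* A label for the components of the product graph. As a block of [a] meets the
   middle row at most once, a component is either a block of [b] with the blocks of
   [a] hanging from it, or an upper block of [a]. *)
Let L (u : point3 n) : {set point n} + {set point n} := match u with
  | inl (inl i) => if [pick j | same a (inl i) (inr j)] is Some j
                   then inr (pblock b (inl j)) else inl (pblock a (inl i))
  | inl (inr j) => inr (pblock b (inl j))
  | inr j => inr (pblock b (inr j)) end.

Let LE i j : same a (inl i) (inr j) -> L (inl (inl i)) = inr (pblock b (inl j)).
Proof.
rewrite /L => ij; case: pickP => [k ik|/(_ j)]; last by rewrite ij.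
by congr (inr (pblock b (inl _))); apply: ha; apply: same_trans ij; rewrite same_sym.
Qed.

Let L_joined u v : joined a b u v -> L u = L v.
Proof.
case/connectP=> p + ->{v}; elim: p u => //= w p IH u /andP[uw /IH<-] {p IH}.
case/glueP: uw => -[s [t [-> -> st]]]; last first.
  by move: s t st => [s|s] [t|t]; rewrite same_pblockE => /eqP E; rewrite /= E.
move: s t st => [s|s] [t|t] st.
- rewrite /=; case: pickP => [k sk|h1]; case: pickP => [l tl|h2] //.
  + congr (inr (pblock b (inl _))); apply: ha.
    by apply: same_trans (same_trans st tl); rewrite same_sym.
  + by have := h2 k; rewrite (same_trans _ sk) // same_sym.
  + by have := h1 l; rewrite (same_trans st tl).
  + by move: st; rewrite same_pblockE => /eqP->.
- by rewrite /upper3 (LE st).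
- by rewrite same_sym in st; rewrite /upper3 (LE st).
- by rewrite /= (ha st).
Qed.

Lemma nlh_upper i j : same (a * b)%g (inl i) (inl j) <->
  same a (inl i) (inl j) \/
  exists k l, [/\ same a (inl i) (inr k), same a (inl j) (inr l) & same b (inl k) (inl l)].
Proof.
rewrite same_mul; split=> [/L_joined|[ij|[k [l [ik jl kl]]]]].
- rewrite /=; case: pickP => [k ik|h1]; case: pickP => [l jl|h2] // [/eqP E].
    by right; exists k, l; split; rewrite // same_pblockE.
  by left; rewrite same_pblockE.
- exact: joined_upper.
- apply: joined_trans (joined_upper b ik) _; rewrite joined_sym.
  apply: joined_trans (joined_upper b jl) _; rewrite joined_sym.
  exact: joined_lower kl.
Qed.

Lemma nlh_trans i j : same (a * b)%g (inl i) (inr j) <->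
  exists k, same a (inl i) (inr k) /\ same b (inl k) (inr j).
Proof.
split=> [|[k [ik kj]]]; last exact: mul_trans ik kj.
rewrite same_mul => /L_joined /=; case: pickP => // k ik [/eqP E].
by exists k; split; rewrite // same_pblockE.
Qed.

Lemma nlh_lower i j : same (a * b)%g (inr i) (inr j) = same b (inr i) (inr j).
Proof.
rewrite same_mul; apply/idP/idP => [/L_joined /= [/eqP]|]; first by rewrite -same_pblockE.
exact: joined_lower.
Qed.

End NoLowerHook.

Section NoUpperHook.
Variables a b : npartition n.
Hypothesis hb : no_upper_hook b.

Let mulE : (a * b)%g = flip (flip b * flip a)%g.
Proof. by rewrite flipM !flipK. Qed.

Lemma nuh_lower i j : same (a * b)%g (inr i) (inr j) <->
  same b (inr i) (inr j) \/
  exists k l, [/\ same b (inl k) (inr i), same b (inl l) (inr j) & same a (inr k) (inr l)].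
Proof.
rewrite mulE same_flip /= (nlh_upper _ (no_lower_hook_flip hb)) !same_flip /=.
by split=> -[|[k [l []]]]; try by [left]; move=> h1 h2 h3; right; exists k, l;
  move: h1 h2 h3; rewrite !same_flip /= => h1 h2 h3; split=> //; rewrite same_sym.
Qed.

Lemma nuh_trans i j : same (a * b)%g (inl i) (inr j) <->
  exists k, same a (inl i) (inr k) /\ same b (inl k) (inr j).
Proof.
rewrite mulE same_flip /= same_sym (nlh_trans _ (no_lower_hook_flip hb)).
by split=> -[k []]; rewrite ?same_flip => h1 h2; exists k; rewrite ?same_flip /=;
  rewrite same_sym h2 same_sym.
Qed.

Lemma nuh_upper i j : same (a * b)%g (inl i) (inl j) = same a (inl i) (inl j).
Proof. by rewrite mulE same_flip /= (nlh_lower _ (no_lower_hook_flip hb)) same_flip. Qed.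

End NoUpperHook.
End Products.

(** * Partial identities and order-preserving partial injections *)

Section Involution.
Variable n : nat.
Variables (f : point n -> point n) (fK : involutive f).

Lemma inv_subproof : equivalence_rel (fun x y => (y == x) || (y == f x)).
Proof.
move=> x y z; split; first by rewrite eqxx.
by case/orP=> /eqP -> //; rewrite fK orbC.
Qed.

(** The partition whose blocks are the orbits of an involution. *)
Definition of_inv := of_rel inv_subproof.

Lemma same_of_inv x y : same of_inv x y = (y == x) || (y == f x).
Proof. exact: same_of_rel. Qed.

Lemma of_inv_motzkin :
  (forall x u, f x != x -> f u != u -> u != x -> u != f x ->
     btw (position u) (position (f u)) (position x)
     = btw (position u) (position (f u)) (position (f x))) ->
  of_inv \in motzkin n.
Proof.
move=> nc; apply/motzkinP; split=> [x y u v|x y z]; rewrite !same_of_inv.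
  case/orP=> /eqP-> // /orP[] /eqP->; first by rewrite /btw !addbb.
  rewrite negb_or => /andP[ux ufx].
  have [->//|fx] := eqVneq (f x) x; have [->|fu] := eqVneq (f u) u; last exact: nc.
  by rewrite /btw !addbb.
by case/orP=> /eqP-> /orP[] /eqP-> //; rewrite eqxx.
Qed.

End Involution.

Section Generators.
Variable n : nat.
Implicit Types (a b c p : npartition n) (i j k l : 'I_n) (A B C : {set 'I_n}).

Lemma inl_eq k l : (inl k == inl l :> point n) = (k == l).
Proof. by []. Qed.
Lemma inr_eq k l : (inr k == inr l :> point n) = (k == l).
Proof. by []. Qed.
Lemma inlr_eq k l : (inl k == inr l :> point n) = false.
Proof. by []. Qed.
Lemma inrl_eq k l : (inr k == inl l :> point n) = false.
Proof. by []. Qed.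
Definition point_eqE := (inl_eq, inr_eq, inlr_eq, inrl_eq).

(** For [j] equal or adjacent to [i], the order-preserving partial injection of rank
    n-1 that avoids the upper point [i] and the lower point [j]: it fixes all other
    points, except that it sends [j] to [i]. *)
Definition skip_fun i j (x : point n) : point n := match x with
  | inl k => if k == i then inl k else inr (tperm i j k)
  | inr k => if k == j then inr k else inl (tperm i j k) end.

Lemma skip_funK i j : involutive (skip_fun i j).
Proof.
case=> k /=.
  have [->|kN] := eqVneq k i; rewrite /= ?eqxx //.
  by rewrite -{2}(tpermL i j) (inj_eq perm_inj) (negPf kN) tpermK.
have [->|kN] := eqVneq k j; rewrite /= ?eqxx //.
by rewrite -{2}(tpermR i j) (inj_eq perm_inj) (negPf kN) tpermK.
Qed.

Definition skip i j := of_inv (skip_funK i j).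

(** Equal or adjacent points. *)
Definition close i j := [|| i == j, j == i.+1 :> nat | i == j.+1 :> nat].

Lemma skip_motzkin i j : close i j -> skip i j \in motzkin n.
Proof.
move=> cl; apply: of_inv_motzkin => x u.
have T k : (tperm i j k = (if k == i :> nat then j else if k == j :> nat then i else k) :> nat).
  case: tpermP => [->|->|/eqP h1 /eqP h2]; rewrite ?eqxx //.
    by case: eqP => [->|].
  by rewrite -val_eqE in h1; rewrite -val_eqE in h2; rewrite (negPf h1) (negPf h2).
case: x u => [x|x] [u|u] /=; case: ifP => [|] xi; rewrite ?eqxx //;
 case: ifP => [|] ui; rewrite ?eqxx // /btw /= ?T => _ _; move: xi ui;
 rewrite ?point_eqE -!val_eqE /= ?T;
 move: cl; rewrite /close -val_eqE /=;
 have := ltn_ord x; have := ltn_ord u; have := ltn_ord i; have := ltn_ord j;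
 clear T; do !case: ifP; lia.
Qed.

Lemma skip_trans i j k l : same (skip i j) (inl k) (inr l) = (k != i) && (l == tperm i j k).
Proof. by rewrite same_of_inv inrl_eq /=; case: (k == i). Qed.

(** All blocks are singletons or transverse: the element is, when planar, an
    order-preserving partial injection. *)
Definition hookless a := no_lower_hook a /\ no_upper_hook a.

Lemma skip_hookless i j : hookless (skip i j).
Proof.
by split=> k l; rewrite same_of_inv point_eqE /=; case: ifP => _; rewrite point_eqE ?orbb ?orbF => /eqP.
Qed.

Lemma skip_dom i j : dom (skip i j) = ~: [set i].
Proof.
apply/setP=> k; rewrite !inE; apply/existsP/idP => [[l]|ki]; first by rewrite skip_trans => /andP[].
by exists (tperm i j k); rewrite skip_trans ki /=.
Qed.

Lemma skip_rank i j : close i j -> rank (skip i j) = n.-1.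
Proof.
move=> /skip_motzkin/motzkinP[_ sm].
by rewrite rank_dom // skip_dom cardsC1 card_ord.
Qed.

(** The middle points match: the transverse blocks of [a] and [b] are joined in pairs. *)
Lemma mul_dom_cod a b : no_lower_hook a \/ no_upper_hook b -> cod a = dom b ->
  dom (a * b)%g = dom a /\ cod (a * b)%g = cod b.
Proof.
move=> h E; split; apply/setP=> i; apply/idP/idP.
- exact/subsetP/dom_mul.
- case/domP=> k ik; have : k \in dom b by rewrite -E (same_cod ik).
  by case/domP=> j kj; apply/domP; exists j; apply: mul_trans ik kj.
- exact/subsetP/cod_mul.
- case/codP=> k ik; have : k \in cod a by rewrite E (same_dom ik).
  by case/codP=> j kj; apply/codP; exists j; apply: mul_trans kj ik.
Qed.

Lemma nlh_mul a b : no_lower_hook a -> no_lower_hook b -> no_lower_hook (a * b)%g.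
Proof. by move=> ha hb k l; rewrite nlh_lower //; apply: hb. Qed.

Lemma hookless_mul a b : small a -> hookless a -> hookless b -> hookless (a * b)%g.
Proof.
move=> sm [la ua] [lb ub]; split; first exact: nlh_mul.
by move=> k l; rewrite nuh_upper //; apply: ua.
Qed.

Lemma hookless_flip a : hookless a -> hookless (flip a).
Proof. by case=> la ua; split; [apply: no_lower_hook_flip | apply: no_upper_hook_flip]. Qed.

Lemma hookless1 : hookless 1%g.
Proof. by split=> k l; rewrite same_one => /eqP. Qed.

(** There is only one order-preserving bijection between two sets of points: [a]
    followed by the inverse of [b] has equal domain and codomain. *)
Lemma hookless_eq a b : a \in motzkin n -> b \in motzkin n ->
  hookless a -> hookless b -> dom a = dom b -> cod a = cod b -> a = b.
Proof.
move=> aM bM ha hb Ed Ec.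
have [_ sa] := motzkinP _ aM; have [_ sb] := motzkinP _ bM.
have fb : flip b \in motzkin n by rewrite flip_motzkin.
have sub i k : same a (inl i) (inr k) -> same b (inl i) (inr k).
  move=> ik; have : k \in dom (flip b) by rewrite dom_flip -Ec (same_cod ik).
  case/domP=> j kj; have := mul_trans ik kj => ij.
  have h : no_lower_hook a \/ no_upper_hook (flip b) by left; case: ha.
  have [|D C] := mul_dom_cod h; first by rewrite dom_flip.
  have E : i = j.
    by apply: dom_cod_id ij; [apply: motzkin_mul | rewrite D C cod_flip].
  by move: kj; rewrite -E same_flip /= same_sym.
have eq_tr i k : same a (inl i) (inr k) = same b (inl i) (inr k).
  apply/idP/idP=> [/sub //|ik]; have : i \in dom a by rewrite Ed (same_dom ik).
  by case/domP=> l il; rewrite (small_lower sb ik (sub _ _ il)).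
have eqh c d x y : (forall i j : 'I_n, same c (x i) (y j) -> i = j) ->
    (forall i j : 'I_n, same d (x i) (y j) -> i = j) -> x =1 y ->
    forall i j, same c (x i) (y j) = same d (x i) (y j).
  by move=> hc hd xy i j; apply/idP/idP => [/hc|/hd] ->; rewrite xy samexx.
case: ha hb => la ua [lb ub].
apply: npartition_inj => -[i|i] [j|j]; rewrite ?eq_tr //; first exact: (eqh _ _ inl inl).
  by rewrite same_sym eq_tr same_sym.
exact: (eqh _ _ inr inr).
Qed.

Lemma card_lt m : m <= n -> #|[set k : 'I_n | k < m]| = m.
Proof.
move=> le_mn; rewrite -sum1_card -[RHS]card_ord -sum1_card.
by rewrite (big_ord_widen _ (fun=> 1) le_mn); apply: eq_bigl => k; rewrite inE.
Qed.

Lemma down_closed A : (forall k k' : 'I_n, k' = k.+1 :> nat -> k' \in A -> k \in A) ->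
  A = [set k : 'I_n | k < #|A|].
Proof.
move=> dc.
have le k l : l <= k -> k \in A -> l \in A.
  move=> le_lk; move: (leqnn k); have [m] := ubnP (k - l).
  elim: m k le_lk => // m IH k le_lk km _ kA.
  have [/val_inj->//|ne] := eqVneq (nat_of_ord l) k.
  have hk : k.-1 < n by apply: leq_ltn_trans (leq_pred _) (ltn_ord k).
  apply: (IH (Ordinal hk)) => /=; try lia.
  by apply: (dc _ k) kA => /=; lia.
apply/eqP; rewrite eqEcard card_lt ?leqnn ?andbT; last by rewrite -[leqRHS]card_ord max_card.
apply/subsetP=> k kA; rewrite inE.
have /subset_leq_card : [set l : 'I_n | l < k.+1] \subset A.
  by apply/subsetP=> l; rewrite inE ltnS => /le; apply.
by rewrite card_lt.
Qed.

End Generators.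

Section PartialInjections.
Variable n : nat.
Implicit Types (a b c p : npartition n) (i j k l : 'I_n) (A B C : {set 'I_n}).

(** Closed under products, and containing 1 and all Motzkin elements of rank n-1. *)
Definition contains_top (N : {set npartition n}) := [/\ 1%g \in N,
  forall x y, x \in N -> y \in N -> (x * y)%g \in N &
  forall x, x \in motzkin n -> rank x = n.-1 -> x \in N].

Lemma contains_top_flip N : contains_top N -> contains_top (@flip n @: N).
Proof.
case=> N1 NM Nr; split.
- by apply/imsetP; exists 1%g; rewrite ?flip1.
- move=> _ _ /imsetP[x xN ->] /imsetP[y yN ->]; rewrite -flipM.
  by apply: imset_f; apply: NM.
- move=> x xM xr; rewrite -[x]flipK; apply: imset_f; apply: Nr; rewrite ?flip_motzkin //.
  have fM : flip x \in motzkin n by rewrite flip_motzkin.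
  by rewrite rank_flip //; [case/motzkinP: xM | case/motzkinP: fM].
Qed.

Lemma motzkin_contains_top : contains_top (motzkin n).
Proof. by split=> //; [apply: motzkin_one | apply: motzkin_mul]. Qed.

Lemma partial_identity N C : contains_top N ->
  exists p, [/\ p \in N, p \in motzkin n, hookless p &
    forall i j, same p (inl i) (inr j) = (i == j) && (i \in C)].
Proof.
case=> N1 NM Nr; have [m] := ubnP #|~: C|; elim: m C => // m IH C le_m.
have [->|] := eqVneq C setT.
  exists 1%g; split=> // [||i j]; [exact: motzkin_one | exact: hookless1 |].
  by rewrite same_one inE andbT.
rewrite -subTset => /subsetPn[k _ kC].
case: (IH (k |: C)) => [|p [pN pM ph pE]].
  move: le_m; rewrite ltnS; apply: leq_trans; apply: proper_card; rewrite properEneq.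
  rewrite setCS subsetU1 andbT; apply/eqP => /setP/(_ k).
  by rewrite !inE eqxx /= kC.
have kk : close k k by rewrite /close eqxx.
have sM := skip_motzkin kk.
exists (skip k k * p)%g; split.
- by apply: NM => //; apply: Nr; rewrite ?skip_rank.
- exact: motzkin_mul.
- by apply: hookless_mul => //; [case/motzkinP: sM | apply: skip_hookless].
move=> i j; apply/idP/idP.
  case/nlh_trans=> [|l]; first by case: (skip_hookless k k).
  rewrite skip_trans pE !inE tperm1 perm1 => -[/andP[ik /eqP->]] /andP[/eqP<-].
  by rewrite (negPf ik) eqxx.
case/andP=> /eqP<- iC; have ik : i != k by apply: contraNneq kC => <-.
apply: (mul_trans (k := i)); first by rewrite skip_trans tperm1 perm1 ik /=.
by rewrite pE eqxx !inE iC orbT.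
Qed.

Lemma partial_identity_dom p C : (forall i j, same p (inl i) (inr j) = (i == j) && (i \in C)) ->
  dom p = C /\ cod p = C.
Proof.
move=> pE; split; apply/setP=> i; rewrite inE; apply/existsP/idP => [[j]|iC].
- by rewrite pE => /andP[].
- by exists i; rewrite pE eqxx.
- by rewrite pE => /andP[/eqP->].
- by exists i; rewrite pE eqxx.
Qed.

(** An element of [A] whose predecessor is not in [A] is moved down by one; the sum of
    the elements of [A] decreases until [A] is an initial segment. *)
Lemma shift_down N A : contains_top N ->
  exists p, [/\ p \in N, p \in motzkin n, hookless p, dom p = A &
    cod p = [set k : 'I_n | k < #|A|]].
Proof.
move=> NT; case: (NT) => N1 NM Nr.
have [m] := ubnP (\sum_(k in A) k); elim: m A => // m IH A le_m.
have [/existsP[k /existsP[k' /and3P[/eqP k'E k'A kA]]]|dc] :=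
  boolP [exists k : 'I_n, exists k' : 'I_n, [&& k' == k.+1 :> nat, k' \in A & k \notin A]];
  last first.
  case: (partial_identity A NT) => p [pN pM ph /partial_identity_dom[pd pc]].
  exists p; split=> //; rewrite pc; apply: down_closed => k k' k'E k'A.
  apply: contraNT dc => kA; apply/existsP; exists k; apply/existsP; exists k'.
  by rewrite k'E eqxx k'A kA.
pose A' := k |: (A :\ k').
have kk' : k != k' by rewrite -val_eqE /= k'E neq_ltn ltnSn.
have cA' : #|A'| = #|A|.
  by rewrite cardsU1 !inE (negPf kA) andbF (cardsD1 k' A) k'A.
case: (IH A') => [|q [qN qM qh qd qc]].
  rewrite big_setU1 /= ?inE ?(negPf kA) ?andbF //.
  by move: le_m; rewrite (big_setD1 k') //= k'E ltnS addSn.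
have cl : close k k' by rewrite /close k'E eqxx orbT.
have sM := skip_motzkin cl; have [sl su] := skip_hookless k k'.
have dE : dom (skip k k' * q)%g = A.
  apply/setP=> i; apply/domP/idP => [[j /(nlh_trans _ sl)[l []]]|iA].
    rewrite skip_trans => /andP[ik /eqP lE] /same_dom; rewrite qd lE !inE.
    case: tpermP => [iE|->|_ _] //; first by rewrite iE eqxx in ik.
    by rewrite (negPf ik) => /andP[].
  have ik : i != k by apply: contraNneq kA => <-.
  have : tperm k k' i \in dom q.
    rewrite qd !inE; case: tpermP => [iE|_|/eqP h1 /eqP h2]; rewrite ?eqxx ?h2 ?iA ?orbT //.
    by rewrite iE eqxx in ik.
  case/domP=> j ij; exists j; apply: mul_trans ij; by rewrite skip_trans ik eqxx.
exists (skip k k' * q)%g; split=> //.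
- by apply: NM => //; apply: Nr; rewrite ?skip_rank.
- exact: motzkin_mul.
- by apply: hookless_mul => //; case/motzkinP: sM.
have [_ sm] := motzkinP _ (motzkin_mul sM qM); have [_ sq] := motzkinP _ qM.
rewrite -cA' -qc; apply/eqP; rewrite eqEcard cod_mul /=.
by rewrite -card_dom_cod // -card_dom_cod // dE qd cA'.
Qed.

Lemma partial_injection N A B : contains_top N -> #|A| = #|B| ->
  exists p, [/\ p \in N, p \in motzkin n, hookless p, dom p = A & cod p = B].
Proof.
move=> NT AB; case: (NT) => _ NM _.
case: (shift_down A NT) => p [pN pM ph pd pc].
case: (shift_down B (contains_top_flip NT)) => q [/imsetP[r rN qE] qM qh qd qc].
have rE : r = flip q by rewrite qE flipK.
have rM : r \in motzkin n by rewrite rE flip_motzkin.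
have rh : hookless r by rewrite rE; apply: hookless_flip.
have [||D C] := @mul_dom_cod _ p r; first by left; case: ph.
  by rewrite pc rE dom_flip qc AB.
exists (p * r)%g; split; rewrite ?D ?C // ?rE ?cod_flip -?rE //.
- exact: NM.
- exact: motzkin_mul.
- by apply: hookless_mul => //; case/motzkinP: pM.
Qed.

End PartialInjections.

(** * Hooks and generation *)

Section Generation.
Variable n : nat.
Implicit Types (a b c p : npartition n) (i j k l : 'I_n) (A B C : {set 'I_n}).

(** For consecutive points, some element of rank n-2 has them as a hook. *)
Definition contains_upper_hooks (N : {set npartition n}) :=
  forall i j, j = i.+1 :> nat -> exists g,
    [/\ g \in N, g \in motzkin n, rank g = n.-2 & same g (inl i) (inl j)].

Definition contains_lower_hooks (N : {set npartition n}) :=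
  forall i j, j = i.+1 :> nat -> exists g,
    [/\ g \in N, g \in motzkin n, rank g = n.-2 & same g (inr i) (inr j)].

Lemma hook_notin_dom a i j : small a -> i != j -> same a (inl i) (inl j) ->
  i \notin dom a /\ j \notin dom a.
Proof.
move=> sm ne ij; split; first by apply: contra ne => iD; rewrite (small_dom_upper sm iD ij).
by rewrite same_sym in ij; apply: contra ne => jD; rewrite (small_dom_upper sm jD ij).
Qed.

Lemma hook_dom a i j : a \in motzkin n -> rank a = n.-2 -> i != j ->
  same a (inl i) (inl j) -> dom a = ~: [set i; j].
Proof.
move=> /motzkinP[_ sm] ra ne ij; have [iD jD] := hook_notin_dom sm ne ij.
apply/eqP; rewrite eqEcard -rank_dom // ra; apply/andP; split.
  by apply/subsetP=> k kD; rewrite !inE; apply/norP; split; apply: contraTneq kD => ->.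
by have := cardsC [set i; j]; rewrite card_ord cards2 ne /=; lia.
Qed.

(** The element with the single upper hook {i, j}, singletons at the points under it
    and at the lower points from [i] to [j], and the identity outside. It is obtained
    by induction on [j - i]: composing on the left with [skip] lengthens the hook. *)
Lemma hook_element N i j : contains_top N -> contains_upper_hooks N -> i < j ->
  exists h, [/\ h \in N, h \in motzkin n, no_lower_hook h,
    forall k l, same h (inl k) (inl l) =
      [|| k == l, (k == i) && (l == j) | (k == j) && (l == i)] &
    forall k l, same h (inl k) (inr l) = (k == l) && ((k < i) || (j < k))].
Proof.
move=> NT NU; case: (NT) => N1 NM Nr.
have [d] := ubnP (j - i); elim: d j => // d IH j le_d lt_ij.
have [jE|jN] := eqVneq (nat_of_ord j) i.+1.
  case: (NU _ _ jE) => g [gN gM rg gij].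
  have [_ sg] := motzkinP _ gM.
  have ne : i != j by rewrite -val_eqE /= neq_ltn lt_ij.
  have gd := hook_dom gM rg ne gij.
  case: (@partial_injection _ N (cod g) (dom g) NT) => [|p [pN pM [pl pu] pd pc]].
    exact/esym/card_dom_cod.
  have [_ sp] := motzkinP _ pM.
  have hM := motzkin_mul gM pM; have [_ sh] := motzkinP _ hM.
  have [||D C] := @mul_dom_cod _ g p; [by right | by rewrite pd |].
  have tr k l : same (g * p)%g (inl k) (inr l) -> k = l.
    by apply: dom_cod_id hM _; rewrite D C.
  exists (g * p)%g; split=> //; first exact: NM.
  - move=> k l /(nuh_lower _ pu) [/pl //|[k' [l' [h1 h2 h3]]]].
    have E := small_cod_lower sg _ h3; rewrite -pd (same_dom h1) in E.
    by rewrite -(E isT) in h2; apply: small_lower h1 h2.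
  - move=> k l; rewrite nuh_upper //; apply/idP/idP => [kl|].
      have [//|nkl] := eqVneq k l; have [] := hook_notin_dom sg nkl kl.
      rewrite gd !inE !negbK => /orP[] /eqP kE /orP[] /eqP lE; subst k l;
      by rewrite ?eqxx ?orbT // eqxx in nkl *.
    case/or3P=> [/eqP->|/andP[/eqP-> /eqP->]//|/andP[/eqP-> /eqP->]]; first exact: samexx.
    by rewrite same_sym.
  - move=> k l; have kD : (k \in dom g) = (k < i) || (j < k).
      by rewrite gd !inE -!val_eqE /= jE; lia.
    rewrite -kD -D; apply/idP/andP => [kl|[/eqP<- /domP[l' kl']]].
      by rewrite (tr _ _ kl) eqxx -{1}(tr _ _ kl) (same_dom kl).
    by rewrite {2}(tr _ _ kl').
have [j' j'E] : exists j' : 'I_n, j = j'.+1 :> nat.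
  have hj' : j.-1 < n by apply: leq_ltn_trans (leq_pred _) (ltn_ord j).
  by exists (Ordinal hj'); rewrite /= prednK // (leq_trans _ lt_ij).
case: (IH j') => [||h [hN hM hl hU hT]]; [by rewrite /=; lia | by rewrite /=; lia |].
case: (partial_identity (~: [set j]) NT) => p [pN pM [pl pu] pE].
have cl : close j' j by rewrite /close j'E eqxx orbT.
have sM := skip_motzkin cl; have [sl su] := skip_hookless j' j.
have h2U k l : same (h * p)%g (inl k) (inl l) = same h (inl k) (inl l) by rewrite nuh_upper.
have h2T k l : same (h * p)%g (inl k) (inr l) = [&& k == l, (k < i) || (j' < k) & k != j].
  apply/idP/idP=> [/(nlh_trans _ hl)[m []]|/and3P[/eqP<- h1 h2]].
    by rewrite hT pE !inE => /andP[/eqP<- ->].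
  by apply: (mul_trans (k := k)); rewrite ?hT ?pE ?inE ?eqxx ?h1 ?h2.
have h2l : no_lower_hook (h * p)%g by apply: nlh_mul.
have h2M := motzkin_mul hM pM.
exists (skip j' j * (h * p))%g; split.
- by apply: (NM); [apply: Nr; rewrite ?skip_rank | apply: NM].
- exact: motzkin_mul.
- exact: nlh_mul.
- have tI : tperm j' j i = i by rewrite tpermD //; clear -j'E lt_ij jN; rewrite -val_eqE /=; lia.
  have ti m : (tperm j' j m == i) = (m == i) by rewrite -[X in _ == X]tI (inj_eq perm_inj).
  have tj m : (tperm j' j m == j') = (m == j).
    by rewrite -[X in _ == X](tpermR j' j) (inj_eq perm_inj).
  move=> k l; apply/idP/idP => [/(nlh_upper _ sl)[/su ->|[k' [l' []]]]|].
  + by rewrite eqxx.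
  + rewrite !skip_trans => /andP[kj /eqP->] /andP[lj /eqP->].
    by rewrite h2U hU (inj_eq perm_inj) !ti !tj.
  + have ij : i != j' by clear -j'E jN; rewrite -val_eqE /=; lia.
    have jj : j != j' by rewrite -val_eqE /= j'E neq_ltn ltnSn orbT.
    have X : same (skip j' j * (h * p))%g (inl i) (inl j).
      apply/(nlh_upper _ sl); right; exists i, j'.
      by rewrite !skip_trans ij jj tI tpermR !eqxx h2U hU !eqxx orbT.
    case/or3P=> [/eqP->|/andP[/eqP-> /eqP->]//|/andP[/eqP-> /eqP->]]; first exact: samexx.
    by rewrite same_sym.
- move=> k l; apply/idP/idP => [/(nlh_trans _ sl)[k' []]|/andP[/eqP<- kij]].
    rewrite skip_trans h2T => /andP[kj /eqP->] /and3P[/eqP<-].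
    move: kj; rewrite -!val_eqE; clear -j'E lt_ij jN.
    by case: tpermP => [->|->|/eqP + /eqP +]; rewrite -?val_eqE /=; lia.
  apply/(nlh_trans _ sl); exists k; rewrite skip_trans h2T eqxx.
  by rewrite tpermD; clear -j'E lt_ij jN kij; rewrite -?val_eqE /=; lia.
Qed.

(** By induction on the number of upper hooks. An innermost hook {i, j} of [a] has only
    singletons under it, so [a] is the product of the element with this single hook and
    of [b], which is [a] with that hook cut into two singletons. *)
Lemma nlh_generated N a : contains_top N -> contains_upper_hooks N ->
  a \in motzkin n -> no_lower_hook a -> a \in N.
Proof.
move=> NT NU; case: (NT) => N1 NM Nr.
pose hk a := [set q : 'I_n * 'I_n | same a (inl q.1) (inl q.2) && (q.1 < q.2)].
have [m] := ubnP #|hk a|; elim: m a => // m IH a le_m aM al.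
have [nc sm] := motzkinP _ aM.
have [E|[q0 q0h]] := set_0Vmem (hk a).
  have au : no_upper_hook a.
    move=> k l kl; case: (ltngtP k l) => [lt|lt|/val_inj //].
      by have : (k, l) \in hk a; [rewrite inE kl | rewrite E inE].
    by have : (l, k) \in hk a; [rewrite inE same_sym kl | rewrite E inE].
  case: (@partial_injection _ N (dom a) (cod a) NT (card_dom_cod sm)) => p [pN pM ph pd pc].
  by rewrite (@hookless_eq _ a p) //.
case: (arg_minnP (P := [in hk a]) (fun q => q.2 - q.1) q0h) => -[i j] /= ijh jmin {q0 q0h}.
move: (ijh); rewrite inE /= => /andP[ij lt_ij].
have nij : i != j by rewrite -val_eqE /=; lia.
have [iD jD] := hook_notin_dom sm nij ij.
have inner k y : i < k -> k < j -> same a (inl k) y -> y = inl k.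
  move=> ik kj ky; have [//|ne] := eqVneq y (inl k).
  have nki : ~~ same a (inl k) (inl i).
    apply/negP=> ki; rewrite same_sym in ki.
    have nik : i != k by rewrite -val_eqE /= neq_ltn ik.
    by move: kj; rewrite (@inl_inj 'I_n 'I_n _ _ (sm _ _ _ ij ki nij nik)) ltnn.
  have := nc _ _ _ _ ky ij nki; rewrite /btw /=.
  case: y ne ky => [l|l] ne ky /=; last by clear -ik kj; have := ltn_ord l; lia.
  rewrite !ltn_add2l => E; have [il lj] : i < l /\ l < j.
    have nl : ~~ same a (inl l) (inl i) by apply: contra nki => /(same_trans ky).
    have nl1 : l != i by apply: contraNneq nl => ->; apply: samexx.
    have nl2 : l != j by apply: contraNneq nl => ->; rewrite same_sym.
    by clear -ik kj nl1 nl2 E; move: nl1 nl2 E; rewrite -!val_eqE /=; lia.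
  rewrite point_eqE -val_eqE /= in ne.
  case: (ltngtP k l) => [lt|lt|E']; last by rewrite E' eqxx in ne.
    by have := jmin (k, l); rewrite inE ky lt => /(_ isT) /=; clear -ik kj il lj lt; lia.
  by have := jmin (l, k); rewrite inE same_sym ky lt => /(_ isT) /=; clear -ik kj il lj lt; lia.
have ii : close i i by rewrite /close eqxx.
have sM := skip_motzkin ii; have [sl su] := skip_hookless i i.
pose b := (skip i i * a)%g.
have bU k l : same b (inl k) (inl l) = (k == l) || [&& k != i, l != i & same a (inl k) (inl l)].
  apply/idP/idP => [/(nlh_upper _ sl)[/su->|[k' [l' []]]]|].
  - by rewrite eqxx.
  - by rewrite !skip_trans tperm1 !perm1 => /andP[-> /eqP->] /andP[-> /eqP->] ->; rewrite orbT.
  case/orP=> [/eqP->|/and3P[ki li kl]]; first exact: samexx.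
  by apply/(nlh_upper _ sl); right; exists k, l; rewrite !skip_trans tperm1 !perm1 ki li !eqxx.
have bT k l : same b (inl k) (inr l) = (k != i) && same a (inl k) (inr l).
  apply/idP/idP => [/(nlh_trans _ sl)[k' []]|/andP[ki kl]].
    by rewrite skip_trans tperm1 perm1 => /andP[-> /eqP->] ->.
  by apply/(nlh_trans _ sl); exists k; rewrite skip_trans tperm1 perm1 ki eqxx.
have bL k l : same b (inr k) (inr l) = same a (inr k) (inr l) by rewrite nlh_lower.
have bN : b \in N.
  have bM : b \in motzkin n by exact: motzkin_mul.
  have bl : no_lower_hook b by apply: nlh_mul.
  apply: IH => //; move: le_m; rewrite ltnS; apply: leq_trans; apply: proper_card.
  apply/properP; split; last by exists (i, j); rewrite // inE /= bU eqxx (negPf nij).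
  apply/subsetP=> -[k l]; rewrite !inE /= bU => /andP[/orP[/eqP->|/and3P[_ _ ->]] ->//].
  by rewrite samexx.
case: (hook_element NT NU lt_ij) => h [hN hM hl hU hT].
suff -> : a = (h * b)%g by apply: NM.
have outer k : k \in dom a -> (k < i) || (j < k).
  move=> kD; have [l kl] := domP _ _ kD; apply: contraT; rewrite negb_or -!leqNgt => /andP[ik kj].
  have ki : k != i by apply: contraNneq iD => <-.
  have kj' : k != j by apply: contraNneq jD => <-.
  by have := inner k (inr l); rewrite -!val_eqE /= in ki kj' => /(_ _ _ kl) H;
     have := H; rewrite !ltn_neqAle ik kj eq_sym ki kj' => /(_ isT isT).
have outU k l : k != l -> same a (inl k) (inl l) ->
    [|| (k == i) && (l == j), (k == j) && (l == i) |
    [&& (k < i) || (j < k), (l < i) || (j < l), k != i & l != i]].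
  have ji : same a (inl j) (inl i) by rewrite same_sym.
  have third x y z : same a (inl x) (inl y) -> x != y -> same a (inl x) (inl z) -> x != z -> y = z.
    by move=> xy nxy xz nxz; apply: (@inl_inj 'I_n); apply: sm xy xz _ _.
  move=> nkl kl; have lk : same a (inl l) (inl k) by rewrite same_sym.
  have [kE|ki] := eqVneq k i; first by subst k; rewrite (third _ _ _ kl nkl ij nij) eqxx.
  have [lE|li] := eqVneq l i.
    by subst l; rewrite eq_sym in nkl; rewrite (third _ _ _ lk nkl ij nij) eqxx orbT.
  have nji : j != i by rewrite eq_sym.
  have kj : k != j.
    by apply: contraNneq li => kE; subst k; rewrite (third _ _ _ kl nkl ji nji).
  have lj : l != j.
    apply: contraNneq ki => lE; subst l; rewrite eq_sym in nkl.
    by rewrite (third _ _ _ lk nkl ji nji).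
  have out x y : same a (inl x) (inl y) -> x != y -> x != i -> x != j -> (x < i) || (j < x).
    move=> xy nxy xi xj; apply: contraT; rewrite negb_or -!leqNgt => /andP[ix xj'].
    have yx : y = x.
      apply: (@inl_inj 'I_n 'I_n); apply: inner xy; last by rewrite ltn_neqAle xj' andbT.
      by rewrite ltn_neqAle ix andbT eq_sym.
    by rewrite yx eqxx in nxy.
  rewrite (out _ _ kl) // (out _ _ lk) // 1?eq_sym //=.
  by rewrite !orbT.
have aU k l : same a (inl k) (inl l) = same (h * b)%g (inl k) (inl l).
  apply/idP/idP => [kl|/(nlh_upper _ hl)[|[k' [l' []]]]].
  - have [->|nkl] := eqVneq k l; first exact: samexx.
    apply/(nlh_upper _ hl); case/or3P: (outU _ _ nkl kl) => [H|H|/and4P[h1 h2 h3 h4]].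
    + by left; rewrite hU H orbT.
    + by left; rewrite hU H !orbT.
    + by right; exists k, l; rewrite !hT bU !eqxx h1 h2 h3 h4 kl orbT.
  - rewrite hU => /or3P[/eqP->|/andP[/eqP-> /eqP->] //|/andP[/eqP-> /eqP->]].
      exact: samexx.
    by rewrite same_sym.
  - rewrite !hT bU => /andP[/eqP<- _] /andP[/eqP<- _] /orP[/eqP->|/and3P[] //].
    exact: samexx.
have aT k l : same a (inl k) (inr l) = same (h * b)%g (inl k) (inr l).
  apply/idP/idP => [kl|/(nlh_trans _ hl)[k' []]].
    apply/(nlh_trans _ hl); exists k; rewrite hT bT eqxx outer ?(same_dom kl) // kl.
    by rewrite (_ : k != i) //; apply: contraNneq iD => <-; apply: same_dom kl.
  by rewrite hT bT => /andP[/eqP<- _] /andP[].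
apply: npartition_inj => -[k|k] [l|l]; rewrite ?aU ?aT //.
- by rewrite same_sym aT same_sym.
- by rewrite nlh_lower // bL.
Qed.

(** Composing with a hookless element undoes the transverse part: [a * p] keeps the
    upper half of [a] and is the identity on [dom a]. *)
Lemma right_projection a p : a \in motzkin n -> p \in motzkin n -> hookless p ->
    dom p = cod a -> cod p = dom a ->
  no_lower_hook (a * p)%g /\
  forall i j, same (a * p)%g (inl i) (inr j) = (i == j) && (i \in dom a).
Proof.
move=> aM pM [pl pu] pd pc; have uM := motzkin_mul aM pM.
have [_ sa] := motzkinP _ aM; have [_ sp] := motzkinP _ pM.
have [||D C] := @mul_dom_cod _ a p; [by right | by rewrite pd |]; split.
  move=> i j /(nuh_lower _ pu) [/pl //|[k [l [h1 h2 kl]]]].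
  have kD : k \in cod a by rewrite -pd (same_dom h1).
  by rewrite -(small_cod_lower sa kD kl) in h2; apply: small_lower h1 h2.
move=> i j; have E k : same (a * p)%g (inl i) (inr k) -> i = k.
  by apply: dom_cod_id uM _; rewrite D C.
apply/idP/andP => [ij|[/eqP<-]].
  by rewrite {1}(E _ ij) eqxx -D (same_dom ij).
by rewrite -D => /domP[k ik]; rewrite {2}(E _ ik).
Qed.

(** An element [c] with the upper half of [a] that is the identity on [dom a] fixes [a]. *)
Lemma left_identity a c : small a -> no_lower_hook c ->
    (forall i j, same c (inl i) (inr j) = (i == j) && (i \in dom a)) ->
    (forall i j, same c (inl i) (inl j) = same a (inl i) (inl j)) ->
  (c * a)%g = a.
Proof.
move=> sa cl cT cU.
have T k l : same (c * a)%g (inl k) (inr l) = same a (inl k) (inr l).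
  apply/idP/idP => [/(nlh_trans _ cl)[m []]|kl].
    by rewrite cT => /andP[/eqP<-].
  by apply: mul_trans (kl); rewrite cT eqxx (same_dom kl).
apply: npartition_inj => -[k|k] [l|l]; rewrite ?T //.
- apply/idP/idP => [/(nlh_upper _ cl)[|[k' [l' []]]]|kl]; first by rewrite cU.
    rewrite !cT => /andP[/eqP<- kD] /andP[/eqP<- _] kl.
    by rewrite (small_dom_upper sa kD kl) samexx.
  by apply: mul_upper_sub; rewrite cU.
- by rewrite same_sym T same_sym.
- by rewrite nlh_lower.
Qed.

(** Every Motzkin element factors as [u * v], where [u] carries its upper hooks
    and [v] its lower hooks. *)
Lemma hook_factorization a : a \in motzkin n -> exists u v,
  [/\ u \in motzkin n, no_lower_hook u, v \in motzkin n, no_upper_hook v & a = (u * v)%g].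
Proof.
move=> aM; have [_ sa] := motzkinP _ aM.
have NT := motzkin_contains_top n.
have cdc : #|cod a| = #|dom a| by rewrite card_dom_cod.
case: (partial_injection NT cdc) => p [_ pM ph pd pc].
case: (partial_identity (dom a) NT) => q [_ qM [ql qu] qE].
have [ul uT] := right_projection aM pM ph pd pc; case: ph => pl pu.
have uM := motzkin_mul aM pM.
have vu : no_upper_hook (q * a)%g.
  move=> i j /(nlh_upper _ ql) [/qu //|[k [l []]]].
  rewrite !qE => /andP[/eqP<- iD] /andP[/eqP<- _]; exact: small_dom_upper.
have uq : (a * p * q = a * p)%g.
  have T k l : same (a * p * q)%g (inl k) (inr l) = same (a * p)%g (inl k) (inr l).
    rewrite uT; apply/idP/idP => [/(nlh_trans _ ul)[m []]|/andP[/eqP<- kD]].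
      by rewrite uT qE => /andP[/eqP<- _].
    by apply: (mul_trans (k := k)); rewrite ?uT ?qE eqxx.
  apply: npartition_inj => -[k|k] [l|l].
  - by rewrite nuh_upper.
  - exact: T.
  - by rewrite same_sym T same_sym.
  - rewrite nlh_lower //.
    by apply/idP/idP => [/ql|/ul] ->; rewrite samexx.
exists (a * p)%g, (q * a)%g; split=> //; first exact: motzkin_mul.
rewrite [RHS]mulgA uq; apply/esym/left_identity => // i j; exact: nuh_upper.
Qed.

Theorem motzkin_generated N : contains_top N -> contains_upper_hooks N ->
  contains_lower_hooks N -> motzkin n \subset N.
Proof.
move=> NT NU NL; apply/subsetP=> a /hook_factorization[u [v [uM ul vM vu ->]]].
case: (NT) => _ NM _; apply: NM; first exact: nlh_generated.
have : flip v \in @flip n @: N.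
  apply: nlh_generated; rewrite ?flip_motzkin //; last exact: no_lower_hook_flip.
    exact: contains_top_flip.
  move=> i j /NL[g [gN gM gr gij]]; exists (flip g).
  have fM : flip g \in motzkin n by rewrite flip_motzkin.
  split=> //; first exact: imset_f; last by rewrite same_flip.
  by rewrite rank_flip //; [case/motzkinP: gM | case/motzkinP: fM].
by rewrite mem_imset //; apply: (can_inj (@flipK n)).
Qed.

End Generation.

(** * The maximal subsemigroups *)

Section HookElement.
Variables (n : nat) (i j : 'I_n).
Implicit Types k l : 'I_n.

Definition hook_fun (x : point n) : point n := match x with
  | inl k => if (k == i) || (k == j) then inl (tperm i j k) else inr k
  | inr k => if (k == i) || (k == j) then inr k else inl k end.

Lemma hook_funK : involutive hook_fun.
Proof.
case=> k /=; last by case: ifP => /= [|] ->.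
have [->|ki] := eqVneq k i; first by rewrite /= tpermL eqxx orbT tpermR.
have [->|kj] := eqVneq k j; first by rewrite /= tpermR eqxx tpermL.
by rewrite /= (negPf ki) (negPf kj).
Qed.

(** The element with upper hook {i, j}, lower singletons [i] and [j], and the identity
    elsewhere. *)
Definition hook := of_inv hook_funK.

Lemma hook_motzkin : j = i.+1 :> nat -> hook \in motzkin n.
Proof.
move=> jE; apply: of_inv_motzkin => x u.
have T k : (tperm i j k = (if k == i :> nat then j else if k == j :> nat then i else k) :> nat).
  case: tpermP => [->|->|/eqP h1 /eqP h2]; rewrite ?eqxx //.
    by case: eqP => [->|].
  by rewrite -val_eqE in h1; rewrite -val_eqE in h2; rewrite (negPf h1) (negPf h2).
case: x u => [x|x] [u|u] /=; case: ifP => [|] xi; rewrite ?eqxx //;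
 case: ifP => [|] ui; rewrite ?eqxx // /btw /= ?T => _ _; move: xi ui;
 rewrite ?point_eqE -!val_eqE /= ?T;
 have := ltn_ord x; have := ltn_ord u; have := ltn_ord i; have := ltn_ord j;
 clear T; do ?case: ifP; lia.
Qed.

Lemma hook_upper : same hook (inl i) (inl j).
Proof. by rewrite same_of_inv /= eqxx tpermL eqxx orbT. Qed.

Lemma hook_lower : no_lower_hook hook.
Proof. by move=> k l; rewrite same_of_inv /=; case: ifP => _; rewrite point_eqE ?orbb ?orbF => /eqP. Qed.

Lemma hook_trans k l : same hook (inl k) (inr l) = [&& k == l, k != i & k != j].
Proof.
by rewrite same_of_inv point_eqE /=; case: ifP; rewrite point_eqE /= -negb_or => ->; rewrite ?andbF ?andbT // eq_sym.
Qed.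

Lemma hook_rank : j = i.+1 :> nat -> rank hook = n.-2.
Proof.
move=> jE; have [_ sm] := motzkinP _ (hook_motzkin jE).
have ne : i != j by rewrite -val_eqE /= jE neq_ltn ltnSn.
have E : dom hook = ~: [set i; j].
  apply/setP=> k; rewrite !inE negb_or; apply/existsP/idP => [[l]|kN].
    by rewrite hook_trans => /and3P[_ -> ->].
  by exists k; rewrite hook_trans eqxx.
by have := cardsC [set i; j]; rewrite card_ord cards2 ne -E -rank_dom //=; lia.
Qed.

End HookElement.

Section Blocks.
Variable n : nat.
Implicit Types (a : npartition n) (x y : point n).

Lemma single_block a x : ([set x] \in blocks a) = [forall y, same a x y ==> (y == x)].
Proof.
have /and3P[_ tI _] := blocksP a.
have cov w : w \in cover (blocks a) by rewrite (cover_partition (blocksP a)) inE.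
apply/idP/forallP => [xa y|h].
  by apply/implyP; rewrite /same (def_pblock tI xa (set11 x)) inE.
suff <- : pblock a x = [set x] by apply: pblock_mem.
apply/setP=> y; rewrite inE; apply/idP/eqP => [xy|->]; last exact: samexx.
by apply/eqP; have := h y; rewrite /same xy.
Qed.

Lemma pair_block a x y : small a -> x != y -> ([set x; y] \in blocks a) = same a x y.
Proof.
move=> sm ne; have /and3P[_ tI _] := blocksP a.
have cov w : w \in cover (blocks a) by rewrite (cover_partition (blocksP a)) inE.
apply/idP/idP => [xa|xy]; first by apply/Defs.sameP; exists [set x; y]; rewrite !inE !eqxx orbT.
suff <- : pblock a x = [set x; y] by apply: pblock_mem.
apply/setP=> z; rewrite !inE; apply/idP/orP => [xz|[]/eqP->//]; last exact: samexx.
have [->|nz] := eqVneq z x; first by left.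
by right; rewrite (sm x y z) // eq_sym.
Qed.

End Blocks.

Section RankFacts.
Variable n : nat.
Implicit Types (a b x y : npartition n) (i j k : 'I_n) (A : {set 'I_n}).

Lemma rank_le a : small a -> rank a <= n.
Proof. by move=> sm; rewrite rank_dom // -[leqRHS]card_ord max_card. Qed.

Lemma rank_n a : a \in motzkin n -> rank a = n -> a = 1%g.
Proof.
move=> aM; have [_ sm] := motzkinP _ aM; rewrite rank_dom // => ra.
by apply: motzkin_rank_n => //; apply/eqP; rewrite eqEcard subsetT cardsT card_ord ra leqnn.
Qed.

Lemma rank1 : rank (1%g : npartition n) = n.
Proof.
have [_ sm] := motzkinP _ (motzkin_one n).
by rewrite rank_dom // dom1 cardsT card_ord.
Qed.

Lemma rank_mull a b : a \in motzkin n -> b \in motzkin n -> rank (a * b)%g <= rank a.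
Proof.
move=> aM bM; have [_ sa] := motzkinP _ aM; have [_ sm] := motzkinP _ (motzkin_mul aM bM).
by rewrite !rank_dom // subset_leq_card // dom_mul.
Qed.

Lemma rank_mulr a b : a \in motzkin n -> b \in motzkin n -> rank (a * b)%g <= rank b.
Proof.
move=> aM bM; have [_ sb] := motzkinP _ bM; have [_ sm] := motzkinP _ (motzkin_mul aM bM).
by rewrite !rank_cod // subset_leq_card // cod_mul.
Qed.

Lemma dom_mul_rank a b : a \in motzkin n -> b \in motzkin n ->
  rank (a * b)%g = rank a -> dom (a * b)%g = dom a.
Proof.
move=> aM bM E; have [_ sa] := motzkinP _ aM; have [_ sm] := motzkinP _ (motzkin_mul aM bM).
by apply/eqP; rewrite eqEcard dom_mul -!rank_dom // E leqnn.
Qed.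

Lemma cod_mul_rank a b : a \in motzkin n -> b \in motzkin n ->
  rank (a * b)%g = rank b -> cod (a * b)%g = cod b.
Proof.
move=> aM bM E; have [_ sb] := motzkinP _ bM; have [_ sm] := motzkinP _ (motzkin_mul aM bM).
by apply/eqP; rewrite eqEcard cod_mul -!rank_cod // E leqnn.
Qed.

(** A set of n-1 points misses exactly one point. *)
Lemma card_codim1 A : 0 < n -> #|A| = n.-1 -> exists i, A = ~: [set i].
Proof.
move=> n0 cA; have : #|~: A| == 1.
  by have := cardsC A; rewrite card_ord cA; move: n0; lia.
by case/cards1P=> i E; exists i; rewrite -E setCK.
Qed.

Lemma codim1_hookless a : 0 < n -> a \in motzkin n -> rank a = n.-1 -> hookless a.
Proof.
move=> n0 /motzkinP[_ sa] ra.
split=> k l kl.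
  have lk : same a (inr l) (inr k) by rewrite same_sym.
  move: ra; rewrite rank_cod // => /(card_codim1 n0)[i E].
  have [kE|ki] := eqVneq k i; last by apply: small_cod_lower kl; rewrite // E !inE.
  have [lE|li] := eqVneq l i; first by rewrite kE lE.
  by apply/esym/(small_cod_lower sa) => //; rewrite E !inE.
have lk : same a (inl l) (inl k) by rewrite same_sym.
move: ra; rewrite rank_dom // => /(card_codim1 n0)[i E].
have [kE|ki] := eqVneq k i; last by apply: small_dom_upper kl; rewrite // E !inE.
have [lE|li] := eqVneq l i; first by rewrite kE lE.
by apply/esym/(small_dom_upper sa) => //; rewrite E !inE.
Qed.

Lemma hookless_upper_single a k : no_upper_hook a -> ([set inl k] \in blocks a) = (k \notin dom a).
Proof.
move=> ua; rewrite single_block; apply/forallP/idP => [h|kD y].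
  by apply/domP=> -[j]; have := h (inr j) => /implyP/[apply].
apply/implyP; case: y => l kl; first by rewrite (ua _ _ kl).
by rewrite (same_dom kl) in kD.
Qed.

Lemma hookless_lower_single a k : no_lower_hook a -> ([set inr k] \in blocks a) = (k \notin cod a).
Proof.
move=> la; rewrite single_block; apply/forallP/idP => [h|kD y].
  by apply/codP=> -[j]; rewrite same_sym; have := h (inl j) => /implyP/[apply].
apply/implyP; case: y => l kl; last by rewrite (la _ _ kl).
by rewrite same_sym in kl; rewrite (same_cod kl) in kD.
Qed.

Lemma codim1_element i j : exists p, [/\ p \in motzkin n, rank p = n.-1,
  dom p = ~: [set i] & cod p = ~: [set j]].
Proof.
case: (@partial_injection n _ (~: [set i]) (~: [set j]) (motzkin_contains_top n)).
  by rewrite !cardsC1.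
move=> p [_ pM _ pd pc]; exists p; split=> //.
by have [_ sp] := motzkinP _ pM; rewrite rank_dom // pd cardsC1 card_ord.
Qed.

End RankFacts.

Section Family.
Variable n : nat.
Hypothesis n_ge2 : 2 <= n.
Implicit Types (a b x y : npartition n) (i j k : 'I_n) (A : {set 'I_n}) (M : {set npartition n}).

(** Indices for the sets (a) to (d): [inl None] for (a), [inl (Some A)] for (b), and
    [inr (b, (i, j))] for the hook at [i], [j], an upper hook when [b] is true. *)
Definition family_index : finType := (option {set 'I_n} + bool * ('I_n * 'I_n))%type.
Implicit Types v w : family_index.

(** The side conditions in (b), (c) and (d). *)
Definition valid v := match v with
  | inl None => true
  | inl (Some A) => (A != set0) && (A \proper [set: 'I_n])
  | inr (_, (i, j)) => j == i.+1 :> nat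
  end.

Definition member v : {set npartition n} := match v with
  | inl None => motzkin_nonid n
  | inl (Some A) => motzkin_singletons A
  | inr (true, (i, j)) => motzkin_no_upper_hook i j
  | inr (false, (i, j)) => motzkin_no_lower_hook i j
  end.

(** The Motzkin elements outside [member v] all have rank [n - corank v]. *)
Definition corank v := match v with inl None => 0 | inl _ => 1 | inr _ => 2 end.

(** The condition for a Motzkin element to be outside [member v]. For (b) it is stated
    through domain and codomain: the missing elements are those of rank n-1 whose
    upper singleton is outside [A] and whose lower singleton is inside. *)
Definition missing v x := match v with
  | inl None => x == 1%g
  | inl (Some A) => [&& rank x == n.-1, A \subset dom x & ~: A \subset cod x]
  | inr (true, (i, j)) => (rank x == n.-2) && same x (inl i) (inl j)
  | inr (false, (i, j)) => (rank x == n.-2) && same x (inr i) (inr j)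
  end.

Let n_gt0 : 0 < n. Proof. exact: ltn_trans n_ge2. Qed.

Let succ_neq i j : j = i.+1 :> nat -> i != j.
Proof. by move=> jE; rewrite -val_eqE /= jE neq_ltn ltnSn. Qed.

Lemma memberE v x : valid v -> (x \in member v) = (x \in motzkin n) && ~~ missing v x.
Proof.
case: v => [[A|]|[[] [i j]]] /=.
- case/andP=> A0 AT; rewrite 2!in_setU in_setD inE.
  have [xM|] := boolP (x \in motzkin n); last first.
    move=> xM; rewrite andbF /=; apply/negbTE; rewrite negb_or.
    by apply/andP; split; apply/bigcupP => -[k _]; rewrite inE (negPf xM).
  rewrite /= andbT; have [rx|//] := eqVneq (rank x) n.-1; rewrite /=.
  have [lx ux] := codim1_hookless n_gt0 xM rx.
  rewrite negb_and; congr (_ || _).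
    apply/bigcupP/subsetPn => -[k kA].
      by rewrite inE xM /= hookless_upper_single // => /andP[_ kD]; exists k.
    by move=> kD; exists k; rewrite // inE xM /= hookless_upper_single // rx eqxx.
  apply/bigcupP/subsetPn => -[k kA].
    by rewrite inE xM /= hookless_lower_single // => /andP[_ kD]; exists k.
  by move=> kD; exists k; rewrite // inE xM /= hookless_lower_single // rx eqxx.
- by rewrite in_setD1 andbC.
- move=> /eqP/succ_neq ne; rewrite in_setD 2!inE andbC.
  case xM: (x \in motzkin n) => //=; rewrite pair_block //.
  by have [] := motzkinP _ xM.
- move=> /eqP/succ_neq ne; rewrite in_setD 2!inE andbC.
  case xM: (x \in motzkin n) => //=; rewrite pair_block //.
  by have [] := motzkinP _ xM.
Qed.

Lemma missing_rank v x : missing v x -> rank x = n - corank v.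
Proof.
case: v => [[A|]|[[] [i j]]] /=.
- by case/and3P=> /eqP-> _ _; rewrite subn1.
- by move=> /eqP->; rewrite rank1 subn0.
- by case/andP=> /eqP-> _; rewrite subn2.
- by case/andP=> /eqP-> _; rewrite subn2.
Qed.

(* If [x * y] has the hook and rank n-2, then so has [x], unless both [i] and [j]
   are in the domain of [x], in which case [x] is the identity. *)
Let missing_upper_mul i j x y : j = i.+1 :> nat -> x \in motzkin n -> y \in motzkin n ->
  rank (x * y)%g = n.-2 -> same (x * y)%g (inl i) (inl j) ->
  (rank x == n.-2) && same x (inl i) (inl j) || (rank y == n.-2) && same y (inl i) (inl j).
Proof.
move=> /succ_neq ne xM yM rxy xyij; have [_ sx] := motzkinP _ xM.
have xyM := motzkin_mul xM yM; have [_ sxy] := motzkinP _ xyM.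
have dxy := hook_dom xyM rxy ne xyij.
have same_x : same x (inl i) (inl j) ->
    (rank x == n.-2) && same x (inl i) (inl j) || (rank y == n.-2) && same y (inl i) (inl j).
  move=> xij; have [iD jD] := hook_notin_dom sx ne xij.
  rewrite xij andbT (_ : rank x = n.-2) ?eqxx //; apply/eqP; rewrite eqn_leq.
  rewrite -{2}rxy rank_mull // andbT -rxy !rank_dom // dxy.
  rewrite subset_leq_card //; apply/subsetP=> k kD.
  by rewrite !inE; apply/norP; split; apply: contraTneq kD => ->.
have [iD|iD] := boolP (i \in dom x); last first.
  by apply: same_x; rewrite -(mul_upper y _ iD).
have [jD|jD] := boolP (j \in dom x); last first.
  by apply: same_x; rewrite same_sym -(mul_upper y _ jD) same_sym.
have x1 : x = 1%g.
  apply: motzkin_rank_n => //; apply/eqP; rewrite -subTset; apply/subsetP=> k _.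
  have [->//|ki] := eqVneq k i; have [->//|kj] := eqVneq k j.
  by apply: (subsetP (dom_mul x y)); rewrite dxy !inE negb_or ki.
by move: rxy xyij; rewrite x1 mul1g => -> ->; rewrite eqxx orbT.
Qed.

Lemma missing_mul v x y : valid v -> x \in motzkin n -> y \in motzkin n ->
  missing v (x * y)%g -> missing v x || missing v y.
Proof.
case: v => [[A|]|[[] [i j]]] /= vv xM yM.
- case/and3P=> /eqP rxy Ax Ay.
  have rx := rank_mull xM yM; have ry := rank_mulr xM yM.
  have [_ sx] := motzkinP _ xM; have [_ sy] := motzkinP _ yM.
  have [rxn|rxn] := eqVneq (rank x) n.
    by move: rxy Ax Ay; rewrite (rank_n xM rxn) mul1g => -> -> ->; rewrite eqxx orbT.
  have [ryn|ryn] := eqVneq (rank y) n.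
    by move: rxy Ax Ay; rewrite (rank_n yM ryn) mulg1 => -> -> ->; rewrite eqxx.
  have rx1 : rank x = n.-1 by have := rank_le sx; move: rx rxn n_gt0; rewrite rxy; lia.
  have ry1 : rank y = n.-1 by have := rank_le sy; move: ry ryn n_gt0; rewrite rxy; lia.
  rewrite rx1 ry1 eqxx /=; move: Ax Ay.
  have dE : dom (x * y)%g = dom x by apply: dom_mul_rank; rewrite ?rxy ?rx1.
  have cE : cod (x * y)%g = cod y by apply: cod_mul_rank; rewrite ?rxy ?ry1.
  rewrite dE cE => -> ->; rewrite andbT /=.
  apply: contraT; rewrite negb_or => /andP[/subsetPn[k kA kx] /subsetPn[l lA ly]].
  have [lx ux] := codim1_hookless n_gt0 xM rx1.
  have lx' : l \notin cod x.
    apply: contra ly => /codP[m ml]; have : m \in dom (x * y)%g by rewrite dE (same_dom ml).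
    case/domP=> m' /(nlh_trans _ lx)[l' [ml' /same_dom]].
    by rewrite (small_lower sx ml ml').
  move: rx1; rewrite rank_cod // => /(card_codim1 n_gt0)[z zE].
  move: kx lx'; rewrite zE !inE !negbK => /eqP kE /eqP lE.
  by move: kA; rewrite inE kE -lE lA.
- move=> /eqP xy1; apply/orP; left; apply/eqP; apply: motzkin_rank_n => //.
  by apply/eqP; rewrite -subTset -(dom1 n) -xy1 dom_mul.
- case/andP=> /eqP rxy xyij; exact: missing_upper_mul (eqP vv) xM yM rxy xyij.
- have sm z : z \in motzkin n -> small z by case/motzkinP.
  have fM z : z \in motzkin n -> flip z \in motzkin n by rewrite flip_motzkin.
  have rf z : z \in motzkin n -> rank (flip z) = rank z.
    by move=> zM; apply: rank_flip; [apply: sm | apply: sm (fM _ zM)].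
  case/andP=> /eqP rxy xyij.
  have := missing_upper_mul (eqP vv) (fM _ yM) (fM _ xM).
  rewrite -flipM !rf ?motzkin_mul // !same_flip /= orbC.
  by apply.
Qed.

Lemma missing_witness v : valid v -> exists2 x, x \in motzkin n & missing v x.
Proof.
case: v => [[A|]|[[] [i j]]] /=.
- case/andP=> /set0Pn[k kA] /properP[_ [l _ lA]].
  case: (codim1_element l k) => p [pM pr pd pc]; exists p => //.
  rewrite pr pd pc eqxx setCS sub1set kA andbT /=.
  by apply/subsetP=> m mA; rewrite !inE; apply: contraNneq lA => <-.
- by move=> _; exists 1%g; rewrite ?motzkin_one.
- by move=> /eqP jE; exists (hook i j); rewrite ?hook_motzkin ?hook_rank ?hook_upper ?eqxx.
- move=> /eqP jE; have hM := hook_motzkin jE; exists (flip (hook i j)).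
    by rewrite flip_motzkin.
  have fM : flip (hook i j) \in motzkin n by rewrite flip_motzkin.
  rewrite same_flip hook_upper rank_flip ?hook_rank ?eqxx //.
    by case/motzkinP: hM.
  by case/motzkinP: fM.
Qed.

(** The sets of the family are pairwise incomparable. *)
Lemma missing_inj v w : valid v -> valid w ->
  (forall x, x \in motzkin n -> missing w x -> missing v x) -> v = w.
Proof.
move=> vv vw H.
have cE : corank v = corank w.
  have [x xM xw] := missing_witness vw.
  have := missing_rank xw; rewrite (missing_rank (H _ xM xw)).
  have c2 u : corank u <= 2 by case: u => [[]|].
  by have := c2 v; have := c2 w; lia.
have hk (b : bool) i j (b' : bool) i' j' : j = i.+1 :> nat -> j' = i'.+1 :> nat ->
    (forall x, x \in motzkin n -> missing (inr (b, (i, j))) x -> missing (inr (b', (i', j'))) x) ->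
    (b', (i', j')) = (b, (i, j)).
  move=> jE j'E {}H; have ne := succ_neq jE; have ne' := succ_neq j'E.
  have hM := hook_motzkin jE; have [_ sh] := motzkinP _ hM.
  have fM : flip (hook i j) \in motzkin n by rewrite flip_motzkin.
  have [_ sf] := motzkinP _ fM.
  have [u uM [bu bE]] : exists2 u, u \in motzkin n & missing (inr (b, (i, j))) u /\
      (missing (inr (b', (i', j'))) u -> b' = b /\ same (hook i j) (inl i') (inl j')).
    case: b H => H.
      exists (hook i j) => //=; rewrite hook_rank // hook_upper eqxx; split=> //.
      case: b' {H} => // /hook_lower E; by rewrite E eqxx in ne'.
    exists (flip (hook i j)) => //=.
    rewrite rank_flip // hook_rank // !same_flip /= hook_upper eqxx; split=> //.
    case: b' {H} => // /hook_lower E; by rewrite E eqxx in ne'.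
  have [-> ij'] := bE (H _ uM bu).
  have [iD jD] := hook_notin_dom sh ne' ij'.
  have dE := hook_dom hM (hook_rank jE) ne (hook_upper i j).
  move: iD jD; rewrite dE !inE !negbK -!val_eqE /= => iD jD.
  by congr (_, (_, _)); apply/val_inj => /=; clear -iD jD jE j'E; lia.
case: v w vv vw H cE => [[A|]|[b' [i' j']]] [[B|]|[b [i j]]] //= vv vw H _.
- congr (inl (Some _)); case/andP: vv => A0 AT; case/andP: vw => B0 BT.
  have E l k : l \notin B -> k \in B -> l \notin A /\ k \in A.
    move=> lB kB; case: (codim1_element l k) => p [pM pr pd pc].
    have := H p pM; rewrite pr pd pc eqxx setCS sub1set kB andbT /=.
    have -> : B \subset ~: [set l].
      by apply/subsetP=> m mB; rewrite !inE; apply: contraNneq lB => <-.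
    move=> /(_ isT)/andP[/subsetP h]; rewrite setCS sub1set => ->; split=> //.
    by apply/negP=> /h; rewrite !inE eqxx.
  case/set0Pn: B0 => k0 k0B; case/properP: BT => _ [l0 _ l0B].
  apply/setP=> k; apply/idP/idP => [|kB]; last by case: (E l0 k).
  by apply: contraTT => kB; case: (E k k0).
- by congr inr; apply: hk; [apply/eqP | apply/eqP | ].
Qed.

Lemma member_proper v : valid v -> proper_subsemigroup (motzkin n) (member v).
Proof.
move=> vv; rewrite /proper_subsemigroup /subsemigroup; apply/and3P; split.
- apply/properP; split; first by apply/subsetP=> x; rewrite memberE // => /andP[].
  by have [x xM xv] := missing_witness vv; exists x; rewrite // memberE // xv andbF.
- have [v0|v0] := eqVneq (corank v) 0.
    case: (codim1_element (Ordinal n_gt0) (Ordinal n_gt0)) => p [pM pr _ _].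
    apply/set0Pn; exists p; rewrite memberE // pM /=; apply/negP=> /missing_rank.
    by rewrite pr v0; lia.
  apply/set0Pn; exists 1%g; rewrite memberE // motzkin_one /=; apply/negP=> /missing_rank.
  by rewrite rank1; lia.
apply/forall_inP=> x; rewrite memberE // => /andP[xM xv].
apply/forall_inP=> y; rewrite memberE // => /andP[yM yv].
rewrite memberE // motzkin_mul //=; apply: contra xv => /(missing_mul vv xM yM).
by rewrite (negPf yv) orbF.
Qed.

(** Every proper subsemigroup is contained in a member of the family. *)
Lemma proper_sub_member M : proper_subsemigroup (motzkin n) M ->
  exists2 v, valid v & M \subset member v.
Proof.
case/and3P=> /properP[MS [z zS zM]] _ /forall_inP Mm.
have MM x y : x \in M -> y \in M -> (x * y)%g \in M by move=> /Mm/forall_inP; apply.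
have sub v : valid v -> (forall x, x \in M -> ~~ missing v x) ->
    exists2 v, valid v & M \subset member v.
  move=> vv Mv; exists v => //; apply/subsetP=> x xM.
  by rewrite memberE // (subsetP MS) // Mv.
have [M1|M1] := boolP (1%g \in M); last first.
  by apply: (sub (inl None)) => // x xM /=; apply: contraNneq M1 => <-.
have [/existsP[i /existsP[j /andP[/eqP jE /forall_inP Mij]]]|NU] := boolP
  [exists i : 'I_n, exists j : 'I_n, (j == i.+1 :> nat) &&
    [forall x in M, ~~ ((rank x == n.-2) && same x (inl i) (inl j))]].
  by apply: (sub (inr (true, (i, j)))) => //=; rewrite jE.
have [/existsP[i /existsP[j /andP[/eqP jE /forall_inP Mij]]]|NL] := boolP
  [exists i : 'I_n, exists j : 'I_n, (j == i.+1 :> nat) &&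
    [forall x in M, ~~ ((rank x == n.-2) && same x (inr i) (inr j))]].
  by apply: (sub (inr (false, (i, j)))) => //=; rewrite jE.
(* Otherwise every hook occurs in [M], so an element of rank n-1 must be missing. *)
have [/existsP[t /and3P[tS /eqP tr tM]]|Nt] := boolP
  [exists t : npartition n, [&& t \in motzkin n, rank t == n.-1 & t \notin M]]; last first.
  case/negP: zM; apply: (subsetP _ z zS); apply: motzkin_generated.
  - split=> // x xS xr; apply: contraNT Nt => xM; apply/existsP; exists x.
    by rewrite xS xr eqxx.
  - move=> i j jE; move: NU => /existsPn/(_ i)/existsPn/(_ j); rewrite jE eqxx /=.
    case/forall_inPn=> g gM; rewrite negbK => /andP[/eqP gr gij].
    by exists g; split=> //; apply: (subsetP MS).
  - move=> i j jE; move: NL => /existsPn/(_ i)/existsPn/(_ j); rewrite jE eqxx /=.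
    case/forall_inPn=> g gM; rewrite negbK => /andP[/eqP gr gij].
    by exists g; split=> //; apply: (subsetP MS).
(* [E i j] says that the element of rank n-1 with singletons [i] above and [j] below is
   in [M]. This relation is transitive, and it is not full because [t] is missing. *)
pose E i j := [exists x in M, [&& rank x == n.-1, dom x == ~: [set i] & cod x == ~: [set j]]].
have uniq1 x y i j : x \in motzkin n -> y \in motzkin n -> rank x = n.-1 -> rank y = n.-1 ->
    dom x = ~: [set i] -> cod x = ~: [set j] -> dom y = ~: [set i] -> cod y = ~: [set j] -> x = y.
  move=> xS yS rx ry dx cx dy cy.
  by apply: hookless_eq => //; rewrite ?dx ?cx //; apply: codim1_hookless.
have Etrans i j k : E i j -> E j k -> E i k.
  move=> /exists_inP[x xM /and3P[/eqP rx /eqP dx /eqP cx]].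
  move=> /exists_inP[y yM /and3P[/eqP ry /eqP dy /eqP cy]].
  have xS := subsetP MS _ xM; have yS := subsetP MS _ yM.
  have [lx ux] := codim1_hookless n_gt0 xS rx.
  have [||D C] := @mul_dom_cod _ x y; [by left | by rewrite cx dy |].
  apply/exists_inP; exists (x * y)%g; first exact: MM.
  have [_ sm] := motzkinP _ (motzkin_mul xS yS).
  by rewrite rank_dom // D C dx cy cardsC1 card_ord !eqxx.
(* If only a loop (i, i) were missing, it would be composed of (i, k) and (k, i). *)
have [p [q [npq nE]]] : exists p q, p != q /\ ~~ E p q.
  have [_ st] := motzkinP _ tS.
  have := tr; rewrite rank_dom // => /(card_codim1 n_gt0)[i dt].
  have := tr; rewrite rank_cod // => /(card_codim1 n_gt0)[j ct].
  have nE : ~~ E i j.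
    apply: contra tM => /exists_inP[x xM /and3P[/eqP rx /eqP dx /eqP cx]].
    by rewrite (@uniq1 t x i j) // (subsetP MS).
  have [eij|] := eqVneq i j; last by exists i, j.
  subst j; have [k ki] : exists k, k != i.
    have : 1 < #|'I_n| by rewrite card_ord.
    rewrite (cardD1 i) inE /= add1n ltnS => /card_gt0P[k]; rewrite !inE => /andP[ki _].
    by exists k.
  have [Eik|] := boolP (E i k); last by exists i, k; rewrite eq_sym.
  exists k, i; split=> //; apply: contraNN nE => Eki; exact: Etrans Eki.
(* No pair of [E] leads from the complement of [A], the points reached from [p], to [A]. *)
pose A := [set k | (k != p) && ~~ E p k].
have E_A i j : i \notin A -> j \in A -> ~~ E i j.
  rewrite inE => iA; rewrite inE => /andP[_ pj]; apply: contraNN pj => Eij.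
  have [<-//|ip] := eqVneq i p; rewrite ip /= negbK in iA; exact: Etrans Eij.
apply: (sub (inl (Some A))) => /= [|x xM].
  apply/andP; split; first by apply/set0Pn; exists q; rewrite inE eq_sym npq.
  by apply/properP; split; [exact: subsetT | exists p; rewrite ?inE ?eqxx].
apply/negP=> /and3P[/eqP rx Ax Ay].
have xS := subsetP MS _ xM; have [_ sx] := motzkinP _ xS.
have := rx; rewrite rank_dom // => /(card_codim1 n_gt0)[i dx].
have := rx; rewrite rank_cod // => /(card_codim1 n_gt0)[j cx].
have iA : i \notin A by apply/negP=> /(subsetP Ax); rewrite dx !inE eqxx.
have jA : j \in A.
  by apply: contraT => jA; have := subsetP Ay j; rewrite inE jA cx !inE eqxx => /(_ isT).
case/negP: (E_A _ _ iA jA); apply/exists_inP; exists x => //.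
by rewrite rx dx cx !eqxx.
Qed.

(** A member of the family lies in some maximal subsemigroup, which is itself contained in
    a member; incomparability forces the three to be equal. *)
Theorem maximal_motzkin M : maximal_subsemigroup (motzkin n) M <-> exists2 v, valid v & M = member v.
Proof.
have max_member N : maximal_subsemigroup (motzkin n) N -> exists2 v, valid v & N = member v.
  move=> /maxsetP[Np Nmax]; have [v vv Nv] := proper_sub_member Np.
  by exists v => //; rewrite (Nmax _ (member_proper vv) Nv).
split=> [/max_member //|[v vv ->]].
have [N Nmax vN] := maxset_exists (member_proper vv).
suff -> : member v = N by [].
have [w vw NE] := max_member _ Nmax.
rewrite NE; congr member; apply: missing_inj => // x xM xw.
apply: contraT => xv; have : x \in member v by rewrite memberE // xM.
by move/(subsetP vN); rewrite NE memberE // xw andbF.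
Qed.

End Family.

(** * Green's relations *)

Section Classes.
Variables (T : finType) (R : rel T) (J X : {set T}).
Hypothesis R_equiv : {in J & &, equivalence_rel R}.
Hypothesis X_J : X \subset J.
Hypothesis X_closed : {in J &, forall x y, x \in X -> R x y -> y \in X}.

(** The classes of [R] in [J] that are contained in [X]; they cover [X] when [X] is closed
    under [R]. *)
Definition classes_in := [set B in equivalence_partition R J | B \subset X].

Lemma classes_in_sub : classes_in \subset equivalence_partition R J.
Proof. by apply/subsetP=> B; rewrite inE => /andP[]. Qed.

Let class_in x : x \in X -> [set y in J | R x y] \in classes_in.
Proof.
move=> xX; have xJ := subsetP X_J x xX; rewrite inE imset_f //=.
by apply/subsetP=> y; rewrite inE => /andP[yJ]; apply: X_closed.
Qed.

Lemma cover_classes_in : cover classes_in = X.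
Proof.
apply/setP=> x; apply/bigcupP/idP => [[B]|xX].
  by rewrite inE => /andP[_ /subsetP]; apply.
exists [set y in J | R x y]; first exact: class_in.
have xJ := subsetP X_J x xX.
by rewrite inE xJ /=; have [] := R_equiv xJ xJ xJ.
Qed.

Lemma classes_in_neq0 : X != set0 -> classes_in != set0.
Proof. by case/set0Pn=> x /class_in xX; apply/set0Pn; exists [set y in J | R x y]. Qed.

Lemma classes_in_proper : X \proper J -> classes_in \proper equivalence_partition R J.
Proof.
case/properP=> _ [x xJ xX]; apply/properP; split; first exact: classes_in_sub.
exists [set y in J | R x y]; first exact: imset_f.
rewrite inE imset_f //=; apply: contra xX => /subsetP; apply.
by rewrite inE xJ /=; have [] := R_equiv xJ xJ xJ.
Qed.

End Classes.

Section Green.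
Variable n : nat.
Implicit Types (a b x y : npartition n) (i j k : 'I_n) (M : {set npartition n}).
Notation S := (motzkin n).

Lemma greenL_equiv (J : {set npartition n}) : {in J & &, equivalence_rel (greenL S)}.
Proof. by move=> x y z _ _ _; split=> [|/eqP E]; rewrite /greenL ?eqxx // E. Qed.

Lemma greenR_equiv (J : {set npartition n}) : {in J & &, equivalence_rel (greenR S)}.
Proof. by move=> x y z _ _ _; split=> [|/eqP E]; rewrite /greenR ?eqxx // E. Qed.

Lemma greenR_mul x y : greenR S x y -> exists2 b, b \in S & y = (x * b)%g.
Proof.
move=> /eqP E; have : y \in [set (x * b)%g | b in S].
  by rewrite E; apply/imsetP; exists 1%g; rewrite ?motzkin_one ?mulg1.
by case/imsetP=> b; exists b.
Qed.

Lemma greenL_mul x y : greenL S x y -> exists2 b, b \in S & y = (b * x)%g.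
Proof.
move=> /eqP E; have : y \in [set (b * x)%g | b in S].
  by rewrite E; apply/imsetP; exists 1%g; rewrite ?motzkin_one ?mul1g.
by case/imsetP=> b; exists b.
Qed.

Lemma greenR_sym x y : greenR S x y = greenR S y x.
Proof. exact: eq_sym. Qed.

Lemma greenL_sym x y : greenL S x y = greenL S y x.
Proof. exact: eq_sym. Qed.

Lemma greenR_dom x y : greenR S x y -> dom x = dom y.
Proof.
move=> xy; apply/eqP; rewrite eqEsubset.
have := xy; rewrite greenR_sym => /greenR_mul[b _ {1}->]; rewrite dom_mul.
by have [c _ ->] := greenR_mul xy; rewrite dom_mul.
Qed.

Lemma greenL_cod x y : greenL S x y -> cod x = cod y.
Proof.
move=> xy; apply/eqP; rewrite eqEsubset.
have := xy; rewrite greenL_sym => /greenL_mul[b _ {1}->]; rewrite cod_mul.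
by have [c _ ->] := greenL_mul xy; rewrite cod_mul.
Qed.

(** [x = x * p * y * (q * x)], where [p] is the order-preserving bijection from [cod x]
    to [dom y], and [q] the one from [cod y] to [dom x]. *)
Lemma same_rank_factor x y : x \in S -> y \in S -> rank x = rank y ->
  exists a b, [/\ a \in S, b \in S & x = (a * y * b)%g].
Proof.
move=> xM yM E; have [_ sx] := motzkinP _ xM; have [_ sy] := motzkinP _ yM.
have NT := motzkin_contains_top n.
have c1 : #|cod x| = #|dom y| by rewrite -rank_dom // -rank_cod.
have c2 : #|cod y| = #|dom x| by rewrite -rank_dom // -rank_cod.
case: (partial_injection NT c1) => p [_ pM [pl pu] pd pc].
case: (partial_injection NT c2) => q [_ qM qh qd qc].
have c3 : #|cod x| = #|dom x| by rewrite card_dom_cod.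
have [||D1 C1] := @mul_dom_cod _ x p; [by right | by rewrite pd |].
have xpl : no_lower_hook (x * p)%g.
  move=> i j /(nuh_lower _ pu) [/pl //|[k [l [h1 h2 kl]]]].
  have kD : k \in cod x by rewrite -pd (same_dom h1).
  have [_ sp] := motzkinP _ pM.
  by rewrite -(small_cod_lower sx kD kl) in h2; apply: small_lower h1 h2.
have xpM := motzkin_mul xM pM; have [_ sxp] := motzkinP _ xpM.
have [||D2 C2] := @mul_dom_cod _ (x * p)%g y; [by left | by rewrite C1 |].
have wM := motzkin_mul xpM yM.
have qdw : dom q = cod (x * p * y)%g by rewrite C2.
have qcw : cod q = dom (x * p * y)%g by rewrite D2 D1.
have [ul uT] := right_projection wM qM qh qdw qcw.
exists (x * p)%g, (q * x)%g; split; [exact: xpM | exact: motzkin_mul |].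
have -> : (x * p * y * (q * x) = x * p * y * q * x)%g by rewrite !mulgA.
apply/esym/(left_identity sx ul) => i j; first by rewrite uT D2 D1.
rewrite nuh_upper; last by case: qh.
apply/idP/idP => [/(nlh_upper _ xpl)[|[k [l [ik jl kl]]]]|ij].
- by rewrite nuh_upper.
- have kD : k \in dom y by rewrite -pc -C1 (same_cod ik).
  by rewrite -(small_dom_upper sy kD kl) in jl; rewrite (small_upper sxp ik jl) samexx.
- by apply: mul_upper_sub; rewrite nuh_upper.
Qed.

Lemma motzkin_regular x : x \in S -> exists2 a, a \in S & (x * a * x)%g = x.
Proof.
move=> xM; have [_ sx] := motzkinP _ xM.
have c : #|cod x| = #|dom x| by rewrite card_dom_cod.
case: (partial_injection (motzkin_contains_top n) c) => p [_ pM ph pd pc].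
exists p => //; have [ul uT] := right_projection xM pM ph pd pc.
by apply: left_identity => // i j; rewrite nuh_upper //; case: ph.
Qed.

Lemma greenJ_rank x y : x \in S -> y \in S -> greenJ S x y = (rank x == rank y).
Proof.
have sub u v : u \in S -> v \in S -> rank u = rank v ->
    [set (a * u * b)%g | a in S, b in S] \subset [set (a * v * b)%g | a in S, b in S].
  move=> uM vM /(same_rank_factor uM vM)[c [d [cM dM ->]]].
  apply/subsetP=> _ /imset2P[a b aM bM ->]; apply/imset2P.
  by exists (a * c)%g (d * b)%g; rewrite ?motzkin_mul // !mulgA.
have le u v : u \in S -> v \in S -> greenJ S u v -> rank u <= rank v.
  move=> uM vM /eqP E; have : u \in [set (a * u * b)%g | a in S, b in S].
    by apply/imset2P; exists 1%g 1%g; rewrite ?motzkin_one // mul1g mulg1.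
  rewrite E => /imset2P[a b aM bM ->].
  apply: leq_trans (rank_mull (motzkin_mul aM vM) bM) _; exact: rank_mulr.
move=> xM yM; apply/idP/eqP => [xy|E].
  by apply/eqP; rewrite eqn_leq !le //; rewrite /greenJ eq_sym.
by rewrite /greenJ eqEsubset !sub.
Qed.

(** The Motzkin elements of rank [r]; when there are any, they form a J-class. *)
Definition Jset r := [set x in S | rank x == r].

Lemma Jset_class r x : x \in S -> rank x = r -> Jset r \in Jclasses S.
Proof.
move=> xM xr; apply/imsetP; exists x => //; apply/setP=> y; rewrite !inE.
rewrite -/S; have [yM|yM] := boolP (y \in S); last first.
  by move: yM; rewrite inE => /negPf->.
by move: (yM); rewrite inE => -> /=; rewrite greenJ_rank // xr eq_sym.
Qed.

Lemma Jset_regular r : regular_in S (Jset r).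
Proof.
apply/forall_inP=> x; rewrite 2!inE => /andP[xM _].
have {}xM : x \in S by rewrite inE.
by have [a aM E] := motzkin_regular xM; apply/exists_inP; exists a; rewrite ?E.
Qed.

End Green.

(** * Types and number of the maximal subsemigroups *)

Section Types.
Variable n : nat.
Hypothesis n_ge2 : 2 <= n.
Implicit Types (x y : npartition n) (i j k : 'I_n) (A : {set 'I_n}).

Let in_Jset r x : (x \in Jset n r) = (x \in motzkin n) && (rank x == r).
Proof. by rewrite [LHS]inE. Qed.

Lemma member_arises (v : family_index n) : valid v ->
  arises_from (motzkin n) (member v) (Jset n (n - corank v)).
Proof.
move=> vv; apply/andP; split.
  by have [x xM /missing_rank] := missing_witness vv; apply: Jset_class.
apply/subsetP=> x; rewrite in_setD memberE // in_Jset => /andP[+ xM].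
by rewrite xM negbK => /missing_rank->; rewrite eqxx.
Qed.

Lemma nonid_M1 : type_M1 (motzkin n) (motzkin_nonid n).
Proof.
exists (Jset n n); split.
- by have := @member_arises (inl None) isT; rewrite /= subn0.
- exact: Jset_regular.
apply/setP=> x; rewrite in_setI in_Jset in_setD1 in_set0.
by apply/negP=> /andP[/andP[x1 xM] /andP[_ /eqP rx]]; rewrite (rank_n xM rx) eqxx in x1.
Qed.

Lemma singletons_M2 A : A != set0 -> A \proper [set: 'I_n] ->
  type_M2 (motzkin n) (motzkin_singletons A).
Proof.
move=> A0 AT; have vv : valid (inl (Some A) : family_index n) by rewrite /= A0.
exists (Jset n n.-1); split.
- by have := member_arises vv; rewrite /= subn1.
- exact: Jset_regular.
pose X := [set x in Jset n n.-1 | ~~ (A \subset dom x)].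
pose Y := [set x in Jset n n.-1 | ~~ (~: A \subset cod x)].
have XJ : X \subset Jset n n.-1 by apply/subsetP=> x; rewrite inE => /andP[].
have YJ : Y \subset Jset n n.-1 by apply/subsetP=> x; rewrite inE => /andP[].
have Xc : {in Jset n n.-1 &, forall x y, x \in X -> greenR (motzkin n) x y -> y \in X}.
  by move=> x y xJ yJ; rewrite [x \in _]in_set [y \in _]in_set xJ yJ /= => xA /greenR_dom <-.
have Yc : {in Jset n n.-1 &, forall x y, x \in Y -> greenL (motzkin n) x y -> y \in Y}.
  by move=> x y xJ yJ; rewrite [x \in _]in_set [y \in _]in_set xJ yJ /= => xA /greenL_cod <-.
case/set0Pn: (A0) => k kA; case/properP: (AT) => _ [l _ lA].
have AC m : m \notin A -> A \subset ~: [set m].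
  by move=> mA; apply/subsetP=> m' m'A; rewrite !inE; apply: contraNneq mA => <-.
have CA m : m \in A -> ~: A \subset ~: [set m] by move=> mA; rewrite setCS sub1set.
case: (codim1_element k l) => p [pM pr pd pc].
case: (codim1_element l k) => q [qM qr qd qc].
have pJ : p \in Jset n n.-1 by rewrite in_Jset pM pr /=.
have qJ : q \in Jset n n.-1 by rewrite in_Jset qM qr /=.
have pX : p \in X.
  by rewrite in_set pJ pd /=; apply/subsetPn; exists k; rewrite // !inE eqxx.
have pY : p \in Y.
  by rewrite in_set pJ pc /=; apply/subsetPn; exists l; rewrite !inE ?eqxx.
have qX : q \notin X by rewrite in_set qJ qd /= negbK AC.
have qY : q \notin Y by rewrite in_set qJ qc /= negbK CA.
exists (classes_in (greenL (motzkin n)) (Jset n n.-1) Y).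
exists (classes_in (greenR (motzkin n)) (Jset n n.-1) X); split.
- by apply: classes_in_neq0 => //; apply/set0Pn; exists p.
- by apply: classes_in_proper; [exact: greenL_equiv | apply/properP; split=> //; exists q].
- by apply: classes_in_neq0 => //; apply/set0Pn; exists p.
- by apply: classes_in_proper; [exact: greenR_equiv | apply/properP; split=> //; exists q].
rewrite !cover_classes_in //; [|exact: greenR_equiv|exact: greenL_equiv].
apply/setP=> x; rewrite in_setI in_setU [x \in X]in_set [x \in Y]in_set.
rewrite -[motzkin_singletons A]/(member (inl (Some A))) memberE //= andbC.
have [xJ|] := boolP (x \in Jset n n.-1); last by [].
move: xJ; rewrite in_Jset => /andP[-> ->] /=.
by rewrite negb_and orbC.
Qed.

Lemma upper_hook_M4 i j : j = i.+1 :> nat -> type_M4 (motzkin n) (motzkin_no_upper_hook i j).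
Proof.
move=> jE; have vv : valid (inr (true, (i, j)) : family_index n) by rewrite /= jE.
have ne : i != j by rewrite -val_eqE /= jE neq_ltn ltnSn.
exists (Jset n n.-2); split.
- by have := member_arises vv; rewrite /= subn2.
- exact: Jset_regular.
pose X := [set x in Jset n n.-2 | ~~ same x (inl i) (inl j)].
have XJ : X \subset Jset n n.-2 by apply/subsetP=> x; rewrite inE => /andP[].
have Xc : {in Jset n n.-2 &, forall x y, x \in X -> greenR (motzkin n) x y -> y \in X}.
  move=> x y xJ yJ; rewrite [x \in _]in_set [y \in _]in_set xJ yJ /= => xij xy; apply: contra xij => yij.
  have [_ sy] : noncrossing y /\ small y by apply/motzkinP; move: yJ; rewrite in_Jset => /andP[].
  have [iD _] := hook_notin_dom sy ne yij.
  move: xy; rewrite greenR_sym => /greenR_mul[b _ ->].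
  by rewrite mul_upper.
exists (classes_in (greenR (motzkin n)) (Jset n n.-2) X); split.
- apply: classes_in_neq0 => //.
  case: (partial_identity (~: [set i; j]) (motzkin_contains_top n)) => p [_ pM [_ pu] pE].
  have [pd _] := partial_identity_dom pE; have [_ sp] := motzkinP _ pM.
  apply/set0Pn; exists p; rewrite in_set in_Jset pM rank_dom // pd /=.
  apply/andP; split; last by apply: contra ne => /pu ->.
  by have := cardsC [set i; j]; rewrite card_ord cards2 ne /=; lia.
- exact: classes_in_sub.
rewrite cover_classes_in //; last exact: greenR_equiv.
apply/setP=> x; rewrite in_setI [x \in X]in_set.
rewrite -[motzkin_no_upper_hook i j]/(member (inr (true, (i, j)))) memberE //= andbC.
have [xJ|] := boolP (x \in Jset n n.-2); last by [].
by move: xJ; rewrite in_Jset => /andP[-> ->] /=.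
Qed.

Lemma lower_hook_M3 i j : j = i.+1 :> nat -> type_M3 (motzkin n) (motzkin_no_lower_hook i j).
Proof.
move=> jE; have vv : valid (inr (false, (i, j)) : family_index n) by rewrite /= jE.
have ne : i != j by rewrite -val_eqE /= jE neq_ltn ltnSn.
exists (Jset n n.-2); split.
- by have := member_arises vv; rewrite /= subn2.
- exact: Jset_regular.
pose X := [set x in Jset n n.-2 | ~~ same x (inr i) (inr j)].
have XJ : X \subset Jset n n.-2 by apply/subsetP=> x; rewrite inE => /andP[].
have Xc : {in Jset n n.-2 &, forall x y, x \in X -> greenL (motzkin n) x y -> y \in X}.
  move=> x y xJ yJ; rewrite [x \in _]in_set [y \in _]in_set xJ yJ /= => xij xy; apply: contra xij => yij.
  have [_ sy] : noncrossing (flip y) /\ small (flip y).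
    by apply/motzkinP; rewrite flip_motzkin; move: yJ; rewrite in_Jset => /andP[].
  have fyij : same (flip y) (inl i) (inl j) by rewrite same_flip.
  have [iD _] := hook_notin_dom sy ne fyij.
  move: xy; rewrite greenL_sym => /greenL_mul[b _ xE].
  by move: fyij; rewrite -(mul_upper (flip b) _ iD) -flipM -xE same_flip.
exists (classes_in (greenL (motzkin n)) (Jset n n.-2) X); split.
- apply: classes_in_neq0 => //.
  case: (partial_identity (~: [set i; j]) (motzkin_contains_top n)) => p [_ pM [pl _] pE].
  have [pd _] := partial_identity_dom pE; have [_ sp] := motzkinP _ pM.
  apply/set0Pn; exists p; rewrite in_set in_Jset pM rank_dom // pd /=.
  apply/andP; split; last by apply: contra ne => /pl ->.
  by have := cardsC [set i; j]; rewrite card_ord cards2 ne /=; lia.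
- exact: classes_in_sub.
rewrite cover_classes_in //; last exact: greenL_equiv.
apply/setP=> x; rewrite in_setI [x \in X]in_set.
rewrite -[motzkin_no_lower_hook i j]/(member (inr (false, (i, j)))) memberE //= andbC.
have [xJ|] := boolP (x \in Jset n n.-2); last by [].
by move: xJ; rewrite in_Jset => /andP[-> ->] /=.
Qed.

Lemma card_valid : #|[set v : family_index n | valid v]| = 2 ^ n + 2 * n - 3.
Proof.
pose PA := [set A : {set 'I_n} | (A != set0) && (A \proper [set: 'I_n])].
pose PH := [set q : 'I_n * 'I_n | q.2 == q.1.+1 :> nat].
have cA : #|PA| = 2 ^ n - 2.
  have -> : PA = [set: {set 'I_n}] :\ set0 :\ [set: 'I_n].
    by apply/setP=> A; rewrite !inE properT andbT andbC.
  have T0 : [set: 'I_n] != set0 by apply/set0Pn; exists (Ordinal (ltnW n_ge2)).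
  have cT : #|[set: {set 'I_n}]| = 2 ^ n by rewrite -powersetT card_powerset cardsT card_ord.
  have := cardsD1 set0 [set: {set 'I_n}]; rewrite in_setT cT => ->.
  by rewrite (cardsD1 [set: 'I_n] (_ :\ set0)) in_setD1 T0 in_setT /= addnA addKn.
have cH : #|PH| = n.-1.
  have -> : PH = (fun k : 'I_n.-1 => (widen_ord (leq_pred n) k,
      cast_ord (prednK (ltnW n_ge2)) (lift ord0 k))) @: [set: 'I_n.-1].
    apply/setP=> -[i j]; rewrite inE /=; apply/eqP/imsetP => [jE|[k _ [-> ->]] //].
    have ik : i < n.-1 by have := ltn_ord j; lia.
    by exists (Ordinal ik); rewrite ?in_setT //=; apply: injective_projections; apply/val_inj.
  rewrite card_imset ?cardsT ?card_ord // => k l /(congr1 (fun q => val q.1)) /= E.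
  exact/val_inj.
have -> : [set v : family_index n | valid v] = inl None |: ([set inl (Some A) | A in PA]
    :|: ([set inr (true, q) | q in PH] :|: [set inr (false, q) | q in PH])).
  have inr_inl b (q : 'I_n * 'I_n) : (inr (b, q) \in [set (inl (Some A) : family_index n) | A in PA]) = false.
    by apply/imsetP=> -[].
  have inl_inr b (A : option {set 'I_n}) : (inl A \in [set (inr (b, q) : family_index n) | q in PH]) = false.
    by apply/imsetP=> -[].
  have inr_inr b c q : (inr (b, q) \in [set (inr (c, q) : family_index n) | q in PH])
      = (b == c) && (q \in PH).
    apply/imsetP/andP => [[q' q'H [-> ->]]|[/eqP-> qH]]; first by rewrite eqxx.
    by exists q.
  have inl_inl A : (inl (Some A) \in [set (inl (Some A) : family_index n) | A in PA]) = (A \in PA).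
    by apply: mem_imset => ? ? [].
  apply/setP=> v; rewrite !in_setU in_set1 in_set.
  case: v => [[A|]|[b q]]; rewrite ?inl_inl ?inl_inr ?inr_inl ?inr_inr ?in_set ?orbF //.
  by case: q => q1 q2; case: b => /=; rewrite ?orbF.
have dis (U V : {set family_index n}) : (forall v, v \in U -> v \notin V) -> #|U :|: V| = #|U| + #|V|.
  move=> h; rewrite cardsU (_ : U :&: V = set0) ?cards0 ?subn0 //.
  by apply/setP=> v; rewrite in_setI in_set0; apply/andP=> -[/h/negPf->].
rewrite !dis; first last.
- move=> v /set1P->; rewrite !in_setU !negb_or.
  by apply/and3P; split; apply/imsetP=> -[].
- by move=> _ /imsetP[A _ ->]; rewrite !in_setU negb_or; apply/andP; split; apply/imsetP=> -[].
- by move=> _ /imsetP[q _ ->]; apply/imsetP=> -[].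
rewrite cards1 !card_imset ?cA ?cH; try by move=> ? ? [].
by have : 2 ^ 2 <= 2 ^ n by [rewrite leq_exp2l]; lia.
Qed.

Lemma card_maximal :
  #|[set M : {set npartition n} | maximal_subsemigroup (motzkin n) M]| = 2 ^ n + 2 * n - 3.
Proof.
rewrite -card_valid -(card_in_imset (f := @member n)).
  congr #|pred_of_set _|; apply/setP=> M; rewrite inE; apply/idP/imsetP.
    by move=> /(maximal_motzkin n_ge2)[v vv ->]; exists v; rewrite ?inE.
  by case=> v; rewrite inE => vv ->; apply/(maximal_motzkin n_ge2); exists v.
move=> v w; rewrite !inE => vv vw E; apply: missing_inj => // x xM xw.
by apply: contraT => xv; have := memberE n_ge2 x vv; rewrite E memberE // xM xw xv.
Qed.

End Types.

(** * Degree one *)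

Section DegreeOne.

Let z : npartition 1 := skip ord0 ord0.

Lemma motzkin1T : motzkin 1 = [set: npartition 1].
Proof.
apply/setP=> a; rewrite in_setT; apply/motzkinP; split.
  apply/planarP/forall_inP => A _; apply/forall_inP => B _; apply/implyP => _.
  apply/exists_inP => -[x _ /exists_inP[y _ /exists_inP[u _ /exists_inP[v _]]]].
  have pb (w : point 1) : position w < 2 by case: w => i; rewrite (ord1 i).
  move: (pb x) (pb y) (pb u) (pb v).
  by move: (position x) (position y) (position u) (position v) => p q r s; lia.
apply/smallP/forall_inP => A _; apply: leq_trans (max_card _) _.
by rewrite card_sum card_ord.
Qed.

Lemma degree1_cases (a : npartition 1) : a = 1%g \/ a = z.
Proof.
have aM : a \in motzkin 1 by rewrite motzkin1T inE.
have [_ sa] := motzkinP _ aM.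
have zM : z \in motzkin 1 by rewrite motzkin1T inE.
have zr : rank z = 0 by apply: skip_rank; rewrite /close eqxx.
have [r1|r1] := eqVneq (rank a) 1; first by left; apply: rank_n.
right; have r0 : rank a = 0 by have := rank_le sa; move: r1; lia.
have hook0 (b : npartition 1) : hookless b by split=> k l _; rewrite (ord1 k) (ord1 l).
have [_ sz] := motzkinP _ zM.
have d0 (b : npartition 1) : small b -> rank b = 0 -> dom b = set0 /\ cod b = set0.
  move=> sb br; split; apply: cards0_eq; first by rewrite -(rank_dom sb).
  by rewrite -(rank_cod sb).
have [da ca] := d0 _ sa r0; have [dz cz] := d0 _ sz zr.
by apply: hookless_eq => //; rewrite ?da ?ca.
Qed.

Lemma degree1_neq : 1%g != z.
Proof.
apply/eqP=> E; have : same z (inl ord0) (inr ord0) by rewrite -E same_one.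
by rewrite skip_trans eqxx.
Qed.

Lemma degree1_mulz a : ((z * a)%g = z) * ((a * z)%g = z).
Proof.
have z0 : dom z = set0 by rewrite skip_dom; apply/setP=> i; rewrite !inE ord1.
have c0 : cod z = set0.
  have zM : z \in motzkin 1 by rewrite motzkin1T inE.
  have [_ sz] := motzkinP _ zM.
  by apply/eqP; rewrite -cards_eq0 -card_dom_cod // z0 cards0.
have d1 : cod (1%g : npartition 1) = setT by rewrite -dom_flip flip1 dom1.
split; [case: (degree1_cases (z * a)%g) => // E | case: (degree1_cases (a * z)%g) => // E].
  have := dom_mul z a; rewrite E z0 dom1 => /subsetP/(_ ord0).
  by rewrite !inE => /(_ isT).
have := cod_mul a z; rewrite E c0 d1 => /subsetP/(_ ord0).
by rewrite !inE => /(_ isT).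
Qed.

Lemma motzkin1E : motzkin 1 = [set 1%g; z].
Proof.
rewrite motzkin1T; apply/setP=> a; rewrite !inE.
by case: (degree1_cases a) => ->; rewrite eqxx ?orbT.
Qed.

Lemma card_motzkin1 : #|motzkin 1| = 2.
Proof. by rewrite motzkin1E cards2 degree1_neq. Qed.

Lemma motzkin1_idem (a : npartition 1) : (a * a)%g = a.
Proof. by case: (degree1_cases a) => ->; rewrite ?mulg1 ?degree1_mulz. Qed.

Lemma motzkin1_semilattice : semilattice (motzkin 1).
Proof.
apply/and3P; split.
- apply/andP; split; first by apply/set0Pn; exists 1%g; rewrite motzkin1T inE.
  by apply/forall_inP=> x _; apply/forall_inP=> y _; rewrite motzkin1T inE.
- apply/forall_inP=> x _; apply/forall_inP=> y _.
  by case: (degree1_cases x) => ->; rewrite ?mul1g ?mulg1 ?degree1_mulz.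
- by apply/forall_inP=> x _; rewrite motzkin1_idem.
Qed.

Lemma motzkin1_maximal (M : {set npartition 1}) :
  maximal_subsemigroup (motzkin 1) M <-> exists2 a, a \in motzkin 1 & M = [set a].
Proof.
have proper1 a : proper_subsemigroup (motzkin 1) [set a].
  apply/and3P; split.
  - by rewrite properEcard card_motzkin1 cards1 sub1set motzkin1T inE.
  - by apply/set0Pn; exists a; rewrite inE.
  - by apply/forall_inP=> x /set1P->; apply/forall_inP=> y /set1P->; rewrite motzkin1_idem inE.
have proper_card1 N : proper_subsemigroup (motzkin 1) N -> #|N| <= 1.
  by case/and3P=> /proper_card; rewrite card_motzkin1.
split=> [/maxsetP[Mp Mmax]|[a _ ->]].
  have /and3P[_ /set0Pn[a aM] _] := Mp; exists a; first by rewrite motzkin1T inE.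
  by apply/esym/eqP; rewrite eqEcard sub1set aM cards1 proper_card1.
apply/maxsetP; split=> // N Np aN.
by apply/esym/eqP; rewrite eqEcard aN cards1 proper_card1.
Qed.

End DegreeOne.

Theorem theorem4p10 :
  (forall n : nat, 2 <= n ->
    [/\ (forall M : {set npartition n},
          maximal_subsemigroup (motzkin n) M <->
          [\/ M = motzkin_nonid n,
              exists A : {set 'I_n},
                [/\ A != set0, A \proper [set: 'I_n] & M = motzkin_singletons A],
              exists i j : 'I_n,
                j = i.+1 :> nat /\ M = motzkin_no_upper_hook i j |
              exists i j : 'I_n,
                j = i.+1 :> nat /\ M = motzkin_no_lower_hook i j]),
        [/\ type_M1 (motzkin n) (motzkin_nonid n),
            (forall A : {set 'I_n}, A != set0 -> A \proper [set: 'I_n] ->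
              type_M2 (motzkin n) (motzkin_singletons A)),
            (forall i j : 'I_n, j = i.+1 :> nat ->
              type_M4 (motzkin n) (motzkin_no_upper_hook i j)) &
            (forall i j : 'I_n, j = i.+1 :> nat ->
              type_M3 (motzkin n) (motzkin_no_lower_hook i j))] &
        #|[set M : {set npartition n} | maximal_subsemigroup (motzkin n) M]|
          = 2 ^ n + 2 * n - 3])
  /\
  [/\ motzkin 1 = [set: npartition 1],
      semilattice (motzkin 1),
      #|motzkin 1| = 2 &
      forall M : {set npartition 1},
        maximal_subsemigroup (motzkin 1) M <->
        exists2 a : npartition 1, a \in motzkin 1 & M = [set a]].
Proof.
split; last first.
  split; [exact: motzkin1T | exact: motzkin1_semilattice | exact: card_motzkin1 |].
  exact: motzkin1_maximal.
move=> n n_ge2; split; last exact: card_maximal.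
  move=> M; rewrite maximal_motzkin //; split.
    case=> -[[A|]|[[] [i j]]] /= vv ->.
    - by case/andP: vv => A0 AT; apply: Or42; exists A.
    - exact: Or41.
    - by apply: Or43; exists i, j; split=> //; apply/eqP.
    - by apply: Or44; exists i, j; split=> //; apply/eqP.
  case=> [->|[A [A0 AT ->]]|[i [j [jE ->]]]|[i [j [jE ->]]]].
  - by exists (inl None).
  - by exists (inl (Some A)); rewrite //= A0.
  - by exists (inr (true, (i, j))); rewrite //= jE.
  - by exists (inr (false, (i, j))); rewrite //= jE.
split; [exact: nonid_M1 | exact: singletons_M2 | exact: upper_hook_M4 | exact: lower_hook_M3].
Qed.
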